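(* Let $1<p_0<p<\infty$, let $\Omega\subsetneq X$ be an open set and let $w$ be a semilocally doubling weight for $\Omega$. Assume that $w$ is a $p_0$-Poincaré weight for $\Omega$ and a $p$-Hardy weight for $\Omega$. Then there exist an exponent $q\in(p_0,p)$ and constants $N>C_{\mathrm{QC}}$, $K>1$ and $C_\alpha>0$ such that $$\alpha_{q,w,\Omega}(N,K,\tau)\le C_\alpha\tau$$ whenever $\tau\ge0$.
   Context: Standing assumptions. $X=(X,d,\mu)$, with at least two points, is a metric measure space with a metric $d$ and a positive complete Borel regular measure $\mu$ such that, for some constant $D>1$, $0<\mu(B)<\infty$ and $\mu(2B)\le D\mu(B)$ for all balls $B=B(x,r)=\{y\in X: d(y,x)<r\}$, where $\lambda B=B(x,\lambda r)$. A curve is a rectifiable continuous map $\gamma:[a,b]\to X$, with length $\operatorname{len}(\gamma)$; it connects $x$ to $y$ (or to a set $E$) if $\gamma(a)=x$ and $\gamma(b)=y$ (respectively $\gamma(b)\in E$). $X$ is $C_{\mathrm{QC}}$-quasiconvex for a fixed $C_{\mathrm{QC}}\ge1$: all $x,y\in X$ are connected by a curve of length at most $C_{\mathrm{QC}}d(x,y)$. Open sets $\Omega$ are nonempty, $\Omega^c=X\setminus\Omega$, and $d(x,\Omega^c)=\inf_{y\in\Omega^c}d(x,y)$. Notation. For $\nu\ge 1$, $\Gamma(X)^\nu_{x,y}$ is the set of all curves connecting $x$ to $y$ with length at most $\nu d(x,y)$, and $\Gamma(X)^\nu_{x,E}$ is the set of all curves connecting $x$ to the set $E$ with length at most $\nu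 d(x,E)$. $LC(X)$ is the set of lower semicontinuous real-valued functions on $X$. Weights. A weight for $\Omega$ is a non-negative Borel function $w$ on $X$ with $\int_B w\,d\mu<\infty$ for all balls $B\subset X$ and $w(x)>0$ for almost every $x\in\Omega$; $w(E)=\int_E w\,d\mu$. For $\Omega\subsetneq X$, $w$ is semilocally doubling for $\Omega$ if for every $\kappa>0$ there is a constant $D(w,\kappa)\ge1$ such that $0<w(B(x,r))\le D(w,\kappa)\,w(B(x,r/2))<\infty$ for all $x\in\Omega$ and $0<r\le\kappa d(x,\Omega^c)$. Maximal functions. For $1\le p<\infty$, $0<\kappa<\infty$, $f$ measurable and $x\in\Omega$, $\mathcal M_{p,w,\kappa}f(x)=\sup_{0<r<\kappa d(x,\Omega^c)}\big(\frac1{w(B(x,r))}\int_{B(x,r)}|f|^pw\,d\mu\big)^{1/p}$, and $\mathcal M^R_{p,w,\kappa}f(x)$ is the same supremum restricted to $0<r<\min\{\kappa d(x,\Omega^c),R\}$ (a supremum over the empty set is $0$). $p$-Poincaré weight. For $1\le p<\infty$, a weight $w$ for $\Omega\subsetneq X$ is a $p$-Poincaré weight for $\Omega$ if there are constants $C_{\mathrm A}>0$, $\nu>C_{\mathrm{QC}}$ and $\kappa>1$ such that for each non-negative bounded $g\in LC(X)$ and all $x,y\in\Omega$ with $d(x,y)<d(x,\Omega^c)/(3\kappa)$, $$\inf_{\gamma\in\Gamma(X)^\nu_{x,y}}\int_\gamma g\,ds\le C_{\mathrm A}\,d(x,y)\big(\mathcal M^{\kappa d(x,y)}_{p,w,\kappa}g(x)+\mathcal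 M^{\kappa d(x,y)}_{p,w,\kappa}g(y)\big).$$ $p$-Hardy weight. For $1\le p<\infty$, a weight $w$ for $\Omega\subsetneq X$ is a $p$-Hardy weight for $\Omega$ if there are constants $C_\Gamma>0$, $\nu>C_{\mathrm{QC}}$ and $\kappa>1$ such that for each non-negative bounded $g\in LC(X)$ and every $x\in\Omega$, $$\inf_{\gamma\in\Gamma(X)^\nu_{x,\Omega^c}}\int_\gamma g\,ds\le C_\Gamma\,d(x,\Omega^c)\,\mathcal M_{p,w,\kappa}g(x).$$ The $\alpha$-function. For $\tau\ge0$, $\kappa>1$, $1\le p<\infty$, $x\in\Omega$, let $\mathcal E^{\kappa,\tau}_{p,w,x,\Omega}=\{g\in LC(X):\mathcal M_{p,w,\kappa}g(x)\le\tau\text{ and }g(y)\in[0,1]\text{ for all }y\in X\}$, and for $\nu>C_{\mathrm{QC}}$ let $$\alpha_{p,w,\Omega}(\nu,\kappa,\tau)=\sup_{x\in\Omega}\ \sup_{g\in\mathcal E^{\kappa,\tau}_{p,w,x,\Omega}}\frac{\inf_{\gamma\in\Gamma(X)^\nu_{x,\Omega^c}}\int_\gamma g\,ds}{d(x,\Omega^c)}.$$ *)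

(* Defs.v *)
From HB Require Import structures.
From mathcomp Require Import all_boot all_order all_algebra.
From mathcomp Require Import all_classical all_reals all_analysis.

Set Implicit Arguments.
Unset Strict Implicit.
Unset Printing Implicit Defensive.

Import Order.TTheory GRing.Theory Num.Theory.
Import numFieldNormedType.Exports.

Local Open Scope classical_set_scope.
Local Open Scope ring_scope.

(* The sigma-algebra of the measurable structure is the domain of the measure.
   It is unrelated to the metric until [borel_regular] is assumed below. *)
#[short(type="metricMeasurableType")]
HB.structure Definition MetricMeasurable (R : realType) (d : measure_display) :=
  { T of Metric R T & Measurable d T }.

Definition borel (X : topologicalType) : set_system X := <<s @open X >>.
Arguments borel : clear implicits.

Section metric.
Context {R : realType} {X : metricType R}.

Definition dist_set (x : X) (E : set X) : R := inf [set mdist x y | y in E].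

Definition path_length (f : R -> X) (a b : R) : \bar R :=
  ereal_sup [set (\sum_(t <- zip (a :: s) s) mdist (f t.1) (f t.2))%:E
            | s in itv_partition a b].

(* A curve [a, b] -> X is encoded by a total function whose values outside
   [a, b] play no role. *)
Record curve := Curve {
  curve_fun :> R -> X ;
  cstart : R ;
  cend : R ;
  cstart_le_cend : cstart <= cend ;
  curve_continuous : {within `[cstart, cend], continuous curve_fun} ;
  curve_rectifiable : (path_length curve_fun cstart cend < +oo)%E }.

Definition len (c : curve) : \bar R := path_length c (cstart c) (cend c).

(* c_s (u) = c (max {t in [a, b] | len (c restricted to [a, t]) = u}),
   for 0 <= u <= len c. *)
Definition arclength_param (c : curve) (u : R) : X :=
  c (sup [set t | cstart c <= t <= cend c /\
                  path_length c (cstart c) t = u%:E]).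

Definition curve_integral (g : X -> R) (c : curve) : \bar R :=
  \int[lebesgue_measure]_(u in `[0, fine (len c)])
    (g (arclength_param c u))%:E.

Definition curves_between (nu : R) (x y : X) : set curve :=
  [set c : curve | [/\ c (cstart c) = x, c (cend c) = y &
              (len c <= (nu * mdist x y)%:E)%E]].

Definition curves_to (nu : R) (x : X) (E : set X) : set curve :=
  [set c : curve | [/\ c (cstart c) = x, E (c (cend c)) &
              (len c <= (nu * dist_set x E)%:E)%E]].

Definition quasiconvex (C : R) : Prop :=
  forall x y : X, curves_between C x y !=set0.

Definition LC : set (X -> R) :=
  [set g | lower_semicontinuous (fun x => (g x)%:E)].

End metric.

Arguments curve {R} X.
Arguments quasiconvex {R} X C.
Arguments LC {R} X.

Section measure.
Context {R : realType} {d : measure_display} {X : metricMeasurableType R d}.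
Variable mu : {measure set X -> \bar R}.

Definition borel_regular : Prop :=
  borel X `<=` measurable /\
  forall A, measurable A -> exists B, [/\ borel X B, A `<=` B & mu A = mu B].

Definition doubling_measure (D : R) : Prop :=
  forall (x : X) (r : R), 0 < r ->
    (0 < mu (ball x r) < +oo)%E /\
    (mu (ball x (2 * r)) <= D%:E * mu (ball x r))%E.

Definition borel_function (f : X -> R) : Prop :=
  measurable_fun setT (f : g_sigma_algebraType (@open X) -> R).

Definition weight_of (w : X -> R) (E : set X) : \bar R :=
  \int[mu]_(y in E) (w y)%:E.

Definition weight (Omega : set X) (w : X -> R) : Prop :=
  [/\ borel_function w,
      forall x, 0 <= w x,
      forall (x : X) (r : R), 0 < r -> (weight_of w (ball x r) < +oo)%E &
      {ae mu, forall x, Omega x -> 0 < w x}].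

Definition semilocally_doubling (Omega : set X) (w : X -> R) : Prop :=
  forall kappa : R, 0 < kappa -> exists2 D : R, 1 <= D &
    forall (x : X) (r : R), Omega x -> 0 < r <= kappa * dist_set x (~` Omega) ->
    [/\ (0 < weight_of w (ball x r))%E,
        (weight_of w (ball x r) <= D%:E * weight_of w (ball x (r / 2)))%E &
        (D%:E * weight_of w (ball x (r / 2)) < +oo)%E].

Definition ball_mean (p : R) (w f : X -> R) (x : X) (r : R) : \bar R :=
  (((\int[mu]_(y in ball x r) (`|f y| `^ p * w y)%:E) / weight_of w (ball x r))
     `^ p^-1)%E.

(* Inserting 0, below all the means, makes the supremum over no radii 0. *)
Definition maximal (Omega : set X) (p : R) (w : X -> R) (kappa : R)
    (f : X -> R) (x : X) : \bar R :=
  ereal_sup (0%E |` [set ball_mean p w f x r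
                    | r in [set r | 0 < r < kappa * dist_set x (~` Omega)]]).

Definition maximal_restr (Omega : set X) (p : R) (w : X -> R) (kappa rho : R)
    (f : X -> R) (x : X) : \bar R :=
  ereal_sup (0%E |` [set ball_mean p w f x r
                    | r in [set r | 0 < r <
                        Num.min (kappa * dist_set x (~` Omega)) rho]]).

Definition nonneg_bounded (g : X -> R) : Prop :=
  (forall x, 0 <= g x) /\ exists M, forall x, g x <= M.

Definition poincare_weight (CQC : R) (Omega : set X) (p : R) (w : X -> R) :
    Prop :=
  weight Omega w /\
  exists CA nu kappa : R, [/\ 0 < CA, CQC < nu, 1 < kappa &
    forall g : X -> R, LC X g -> nonneg_bounded g ->
    forall x y, Omega x -> Omega y ->
    mdist x y < dist_set x (~` Omega) / (3 * kappa) ->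
    (ereal_inf [set curve_integral g c | c in curves_between nu x y] <=
     (CA * mdist x y)%:E *
       (maximal_restr Omega p w kappa (kappa * mdist x y) g x +
        maximal_restr Omega p w kappa (kappa * mdist x y) g y))%E].

Definition hardy_weight (CQC : R) (Omega : set X) (p : R) (w : X -> R) : Prop :=
  weight Omega w /\
  exists CG nu kappa : R, [/\ 0 < CG, CQC < nu, 1 < kappa &
    forall g : X -> R, LC X g -> nonneg_bounded g ->
    forall x, Omega x ->
    (ereal_inf [set curve_integral g c | c in curves_to nu x (~` Omega)] <=
     (CG * dist_set x (~` Omega))%:E * maximal Omega p w kappa g x)%E].

Definition alpha_class (Omega : set X) (p : R) (w : X -> R) (kappa tau : R)
    (x : X) : set (X -> R) :=
  [set g | [/\ LC X g, (maximal Omega p w kappa g x <= tau%:E)%E &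
              forall y, 0 <= g y <= 1]].

Definition alpha (Omega : set X) (p : R) (w : X -> R) (nu kappa tau : R) :
    \bar R :=
  ereal_sup [set
    ereal_sup [set
      (ereal_inf [set curve_integral g c | c in curves_to nu x (~` Omega)]
         / (dist_set x (~` Omega))%:E)%E
      | g in alpha_class Omega p w kappa tau x]
    | x in Omega].

End measure.

(* Main.v *)
Require Import Defs.
From mathcomp Require Import all_boot all_order all_algebra.
From mathcomp Require Import finmap all_classical all_reals all_analysis.
From mathcomp Require Import unstable measurable_realfun ring lra.

Set Implicit Arguments.
Unset Strict Implicit.
Unset Printing Implicit Defensive.

Import Order.TTheory GRing.Theory Num.Theory.
Import numFieldNormedType.Exports.

Local Open Scope classical_set_scope.
Local Open Scope ring_scope.

(** For one value of [tau] the claim reads: from every [x] in [Omega] there are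
    curves of length at most [N * d(x)] to the boundary, [d] being the distance
    to the complement, along which [g] has integral at most [C * tau * d(x)], as
    soon as [0 <= g <= 1] and the [q]-maximal function of [g] at [x] is at most
    [tau].  For [tau >= 1] quasiconvexity gives it, because [g <= 1].  For
    smaller [tau] it follows from the same claim, with the same constants, at
    the levels [M^i * tau], [1 <= i <= k] ([hardy_at_step]); so it propagates
    downwards along the powers of [M].

    The step goes as follows.  Let [E_i] be the set where an uncentred [q]-mean
    of [g] exceeds [M^i * tau].  Vitali covering and doubling bound the
    proportion of [E_i] in the balls around [x] by a multiple of [M^(- i q)]
    ([weak_type_high_set]).  Let [h] be the average over [i <= k] of the
    functions [M^i 1_(E_i)].  The terms are so lacunary that [h^p] is comparable
    to the sum of their [p]-th powers divided by [k^p], and each of these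
    contributes about [M^(i (p - q))], that is at most [2] if [q] is close
    enough to [p].  Hence the [p]-means of [h] are of order [k^(1/p - 1)],
    arbitrarily small because [p > 1].  This is the gain that pays for lowering
    the exponent.  The Hardy inequality applied to [h] yields a curve to the
    boundary and a level [i] such that the curve meets [E_i] in length at most
    [delta * M^(- i) * d(x)] ([rarely_high_curve]).

    Only points of this curve are kept.  Walk along it in steps comparable to
    the bound for its part in [E_i]; each can be adjusted to land outside [E_i],
    where the [q]-maximal function, hence the [p0]-maximal function, is at most
    a multiple of [M^i * tau], and the Poincare inequality joins consecutive
    points at a cost proportional to [M^i * tau] times the step.  The walk
    approaches the boundary, so at some point [z] the distance [d(z)] is at most
    a multiple of the step; there the claim at level [M^i * tau] leads to the
    boundary, at a cost of at most [C * M^i * tau * d(z)], a small multiple of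
    [C * tau * d(x)].  Both parts add up to at most [C * tau * d(x)] once [C] is
    large.  The numbers [M], [k], [N], [C] are chosen before [q].

    On the side of curves this uses that arc length parametrizations have unit
    speed and that lengths and line integrals add up under concatenation; only
    finitely many curves are ever concatenated ([joined_chain]). *)

(** * Length of a path *)

Section path_length.
Context {R : realType} {X : metricType R}.
Implicit Types (f : R -> X) (a b c s t u : R) (P : seq R).

Definition chord_sum f a P : R :=
  \sum_(t <- zip (a :: P) P) mdist (f t.1) (f t.2).

Lemma chord_sum_nil f a : chord_sum f a [::] = 0.
Proof. by rewrite /chord_sum /= big_nil. Qed.

Lemma chord_sum_cons f a x P :
  chord_sum f a (x :: P) = mdist (f a) (f x) + chord_sum f x P.
Proof. by rewrite /chord_sum /= big_cons. Qed.

Lemma chord_sum_cat f a P Q :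
  chord_sum f a (P ++ Q) = chord_sum f a P + chord_sum f (last a P) Q.
Proof.
elim: P a => [|x P IH] a /=; first by rewrite chord_sum_nil add0r.
by rewrite !chord_sum_cons IH addrA.
Qed.

Lemma chord_sum_ge0 f a P : 0 <= chord_sum f a P.
Proof. by apply: sumr_ge0 => t _; exact: mdist_ge0. Qed.

Lemma chord_sum_insert f a c P :
  chord_sum f a P <= mdist (f a) (f c) + chord_sum f c P.
Proof.
case: P => [|x P]; first by rewrite !chord_sum_nil addr0 mdist_ge0.
by rewrite !chord_sum_cons addrA lerD2r metric_triangle.
Qed.

Lemma chord_sum_split f a c P : path <%R a P -> a < c ->
  chord_sum f a P <=
  chord_sum f a (itv_partitionL P c) + chord_sum f c (itv_partitionR P c).
Proof.
rewrite /itv_partitionL /itv_partitionR.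
elim: P a => [|x P IH] a /=.
  by rewrite chord_sum_cons !chord_sum_nil !addr0 mdist_ge0.
move=> /andP[ax xP] ac; have [xc|cx|xc] := ltgtP x c.
- by rewrite /= !chord_sum_cons -addrA lerD2l IH.
- rewrite path_lt_filter0; last exact: path_lt_head xP.
  rewrite path_lt_filterT; last exact: path_lt_head xP.
  by rewrite /= (chord_sum_cons _ _ c) chord_sum_nil addr0 chord_sum_insert.
- rewrite -xc path_lt_filter0// path_lt_filterT//=.
  by rewrite !chord_sum_cons chord_sum_nil addr0.
Qed.

Lemma chord_sum_le_length f a b P : itv_partition a b P ->
  ((chord_sum f a P)%:E <= path_length f a b)%E.
Proof. by move=> abP; apply: ereal_sup_ubound; exists P. Qed.

Lemma itv_partition_exists a b : a <= b -> exists P, itv_partition a b P.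
Proof.
rewrite le_eqVlt => /predU1P[->|ab]; last by exists [:: b]; exact: itv_partition1.
by exists [::]; split => //=.
Qed.

Lemma path_length_ge0 f a b : a <= b -> (0 <= path_length f a b)%E.
Proof.
move=> /itv_partition_exists[P abP]; apply: le_trans (chord_sum_le_length f abP).
by rewrite lee_fin chord_sum_ge0.
Qed.

Lemma path_lengthxx f a : path_length f a a = 0%E.
Proof.
apply/eqP; rewrite eq_le path_length_ge0// andbT.
apply: ge_ereal_sup => _ [P /itv_partitionxx -> <-].
by rewrite -/(chord_sum f a [::]) chord_sum_nil.
Qed.

Lemma mdist_le_path_length f a b : a <= b ->
  ((mdist (f a) (f b))%:E <= path_length f a b)%E.
Proof.
rewrite le_eqVlt => /predU1P[->|ab]; first by rewrite path_lengthxx mdistxx.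
rewrite -[mdist _ _]addr0 -(chord_sum_nil f b) -chord_sum_cons.
exact/chord_sum_le_length/itv_partition1.
Qed.

Lemma path_length_cat f a b c : a <= b -> b <= c ->
  path_length f a c = (path_length f a b + path_length f b c)%E.
Proof.
move=> ab bc; apply/eqP; rewrite eq_le; apply/andP; split.
  move: ab; rewrite (le_eqVlt a) => /predU1P[->|ab].
    by rewrite path_lengthxx add0e.
  move: bc; rewrite (le_eqVlt b) => /predU1P[->|bc]; first by rewrite path_lengthxx adde0.
  apply: ge_ereal_sup => _ [P acP <-].
  have [pP _] := acP.
  apply: (@le_trans _ _ (chord_sum f a (itv_partitionL P b) +
                         chord_sum f b (itv_partitionR P b))%:E).
    by rewrite lee_fin chord_sum_split.
  rewrite EFinD leeD//; apply: chord_sum_le_length.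
    exact: itv_partitionLP acP.
  exact: itv_partitionRP acP.
have sumP P Q : itv_partition a b P -> itv_partition b c Q ->
    ((chord_sum f a P)%:E + (chord_sum f b Q)%:E <= path_length f a c)%E.
  move=> abP bcQ; have [_ /eqP lP] := abP.
  rewrite -EFinD -[X in chord_sum _ X Q]lP -chord_sum_cat.
  by apply: chord_sum_le_length; exact: itv_partition_cat abP bcQ.
have sumPL P : itv_partition a b P ->
    ((chord_sum f a P)%:E + path_length f b c <= path_length f a c)%E.
  move=> abP; rewrite addeC -leeBrDr//; apply: ge_ereal_sup => _ [Q bcQ <-].
  by rewrite leeBrDr// addeC; exact: sumP.
have [oo|fin] := eqVneq (path_length f b c) +oo%E.
  have [P /sumPL] := itv_partition_exists ab.
  by rewrite oo addeC addye// leye_eq => /eqP ->; rewrite leey.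
have bcfin : path_length f b c \is a fin_num.
  by rewrite ge0_fin_numE ?path_length_ge0// ltey.
by rewrite -leeBrDr//; apply: ge_ereal_sup => _ [P abP <-]; rewrite leeBrDr ?sumPL.
Qed.

(** If no vertex of a partition lies strictly between [s] and [t], then
    inserting both costs nothing and isolates the chord from [s] to [t]. *)
Lemma chord_sum_le_gap f a b P s t : itv_partition a b P ->
  a <= s -> s < t -> t <= b -> (forall p, p \in P -> s < p -> t <= p) ->
  ((chord_sum f a P)%:E <=
   path_length f a s + ((mdist (f s) (f t))%:E + path_length f t b))%E.
Proof.
move=> abP as_ st tb gap.
have right Q : itv_partition s b Q -> (forall p, p \in Q -> t <= p) ->
    ((chord_sum f s Q)%:E <= (mdist (f s) (f t))%:E + path_length f t b)%E.
  case: Q => [/itv_partition_nil sb|x Q sbQ tQ].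
    by move: st; rewrite sb ltNge tb.
  have tx : t <= x by apply: tQ; rewrite mem_head.
  have [/= /andP[sx xQ] lQ] := sbQ.
  move: tx; rewrite le_eqVlt => /predU1P[tx|tx].
    rewrite chord_sum_cons EFinD -tx leeD2l//; apply: chord_sum_le_length.
    by rewrite tx; split.
  apply: le_trans (_ : (mdist (f s) (f t) + chord_sum f t (x :: Q))%:E <= _)%E.
    by rewrite lee_fin chord_sum_insert.
  rewrite EFinD leeD2l//; apply: chord_sum_le_length.
  by split => //=; rewrite tx.
have [pP _] := abP.
move: as_; rewrite (le_eqVlt a) => /predU1P[as_|as_].
  rewrite -as_ path_lengthxx add0e as_; apply: right; first by rewrite -as_.
  move=> p pP'; apply: gap => //.
  by move: pP; rewrite as_ lt_path_sortedE => /andP[/allP/(_ _ pP')].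
have sb := lt_le_trans st tb.
apply: le_trans (_ : (chord_sum f a (itv_partitionL P s) +
                      chord_sum f s (itv_partitionR P s))%:E <= _)%E.
  by rewrite lee_fin chord_sum_split.
rewrite EFinD leeD//.
  exact/chord_sum_le_length/(itv_partitionLP _ _ abP).
apply: right; first exact: itv_partitionRP abP.
by move=> p; rewrite /itv_partitionR mem_filter => /andP[sp pP']; exact: gap.
Qed.

End path_length.

(** * The length function and its continuity *)

Lemma within_continuous_mdistP {R : realType} {X : metricType R}
    (f : R -> X) (a b : R) :
  {within `[a, b], continuous f} <->
  forall t0, a <= t0 <= b -> forall e : R, 0 < e -> exists2 d : R, 0 < d &
    forall t, a <= t <= b -> `|t - t0| < d -> mdist (f t0) (f t) < e.
Proof.
split=> [/subspace_continuousP fc t0 t0ab e e0|fc].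
  have /fc : `[a, b]%classic t0 by rewrite /= in_itv.
  move=> /metricType_numDomainType.cvgrPdist_lt/(_ _ e0).
  rewrite /prop_near1 /= /within /= => /nbhs_ballP[d/= d0 fd].
  exists d => // t tab td; apply: fd; last by rewrite /= in_itv.
  by rewrite /ball/= distrC.
apply/subspace_continuousP => t0; rewrite /= in_itv/= => t0ab.
apply/metricType_numDomainType.cvgrPdist_lt => e /(fc _ t0ab)[d d0 fd].
rewrite /prop_near1 /= /within /=; apply/nbhs_ballP; exists d => //= t.
by rewrite /ball/= in_itv/= => td tab; apply: fd => //; rewrite distrC.
Qed.

Section length_function.
Context {R : realType} {X : metricType R}.
Variables (f : R -> X) (a b : R).
Hypothesis ab : a <= b.
Hypothesis fcont : {within `[a, b], continuous f}.
Hypothesis frect : (path_length f a b < +oo)%E.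

Definition arclength t : R := fine (path_length f a t).

Lemma path_length_fin_num s t : a <= s -> s <= t -> t <= b ->
  path_length f s t \is a fin_num.
Proof.
move=> as_ st tb; rewrite ge0_fin_numE ?path_length_ge0//.
apply: le_lt_trans frect.
rewrite (path_length_cat f as_ (le_trans st tb)) (path_length_cat f st tb).
by rewrite addeCA leeDl// adde_ge0// path_length_ge0.
Qed.

Lemma arclengthK t : a <= t <= b -> (arclength t)%:E = path_length f a t.
Proof. by move=> /andP[at_ tb]; rewrite fineK// path_length_fin_num. Qed.

Lemma arclengthB s t : a <= s -> s <= t -> t <= b ->
  path_length f s t = (arclength t - arclength s)%:E.
Proof.
move=> as_ st tb; have at_ := le_trans as_ st; have sb := le_trans st tb.
rewrite EFinB !arclengthK ?as_ ?at_// (path_length_cat f as_ st).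
by rewrite [X in (X - _)%E]addeC addeK// path_length_fin_num.
Qed.

Lemma mdist_le_arclength s t : a <= s -> s <= t -> t <= b ->
  mdist (f s) (f t) <= arclength t - arclength s.
Proof.
by move=> as_ st tb; rewrite -lee_fin -arclengthB// mdist_le_path_length.
Qed.

Lemma arclength_le s t : a <= s -> s <= t -> t <= b ->
  arclength s <= arclength t.
Proof.
move=> as_ st tb; rewrite -subr_ge0.
exact: le_trans (mdist_ge0 _ _) (mdist_le_arclength as_ st tb).
Qed.

Lemma arclength_start : arclength a = 0.
Proof. by rewrite /arclength path_lengthxx. Qed.

Lemma seq_isolated (t0 : R) (P : seq R) :
  exists2 e : R, 0 < e & forall p, p \in P -> `|p - t0| < e -> p = t0.
Proof.
elim: P => [|x P [e e0 eP]]; first by exists 1.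
have [->|xt0] := eqVneq x t0.
  by exists e => // p /[!inE] /predU1P[->//|/eP].
exists (Num.min e `|x - t0|); first by rewrite lt_min e0 normr_gt0 subr_eq0.
move=> p /[!inE] /predU1P[->|/eP pe]; rewrite lt_min.
  by rewrite ltxx andbF.
by move=> /andP[/pe].
Qed.

(** A partition almost attaining the length of the whole path almost attains
    it on each of its gaps, where the length is then close to the chord; chords
    are short by continuity. *)
Lemma arclength_continuous t0 (e : R) : a <= t0 <= b -> 0 < e ->
  exists2 d : R, 0 < d & forall t, a <= t <= b -> `|t - t0| < d ->
    `|arclength t - arclength t0| < e.
Proof.
move=> /andP[at0 t0b] e0; have e20 : 0 < e / 2 by rewrite divr_gt0.
have abfin := path_length_fin_num (lexx a) ab (lexx b).
have [_ [P abP <-] Pe] := ub_ereal_sup_adherent e20 abfin.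
rewrite -/(path_length f a b) -/(chord_sum f a P) in Pe.
have [d1 d10 Pd1] := seq_isolated t0 P.
have [|d2 d20 fd2] := (within_continuous_mdistP f a b).1 fcont t0 _ _ e20.
  by rewrite at0.
exists (Num.min d1 d2); first by rewrite lt_min d10.
have key s t : a <= s -> s < t -> t <= b ->
    (forall p, p \in P -> s < p -> t <= p) -> mdist (f s) (f t) < e / 2 ->
    `|arclength t - arclength s| < e.
  move=> as_ st tb gap dst.
  have at_ := le_trans as_ (ltW st); have sb := le_trans (ltW st) tb.
  have /(lt_le_trans Pe) := chord_sum_le_gap f abP as_ st tb gap.
  rewrite -arclengthK ?lexx ?ab// -arclengthK ?as_// arclengthB//.
  rewrite -EFinN -!EFinD lte_fin => H.
  have := arclength_le as_ (ltW st) tb.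
  by rewrite ltr_norml; lra.
move=> t /andP[at_ tb]; rewrite lt_min => /andP[td1 td2].
have dt : mdist (f t0) (f t) < e / 2 by apply: fd2 => //; rewrite at_.
have [tt0|t0t|->] := ltgtP t t0; last by rewrite subrr normr0.
- rewrite distrC; apply: key => //; last by rewrite metric_sym.
  move=> p pP tp; rewrite leNgt; apply/negP => pt0.
  have := Pd1 _ pP; rewrite (lt_trans _ td1); last first.
    by rewrite !ltr0_norm ?subr_lt0//; lra.
  by move=> /(_ isT) pE; move: pt0; rewrite pE ltxx.
- apply: key => // p pP tp; rewrite leNgt; apply/negP => pt0.
  have := Pd1 _ pP; rewrite (lt_trans _ td1); last first.
    by rewrite !gtr0_norm ?subr_gt0//; lra.
  by move=> /(_ isT) pE; move: tp; rewrite pE ltxx.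
Qed.

(** By continuity the length function takes all intermediate values, and takes
    each of them for a last time: the supremum that defines the arc length
    parametrization is a maximum. *)
Lemma arclength_last_time u : 0 <= u <= arclength b ->
  exists T, [/\ a <= T <= b, arclength T = u,
    forall t, a <= t <= b -> arclength t = u -> t <= T &
    sup [set t | a <= t <= b /\ path_length f a t = u%:E] = T].
Proof.
move=> /andP[u0 ub]; pose S := [set t | a <= t <= b /\ arclength t <= u].
have Sa : S a by rewrite /S/= lexx ab arclength_start.
have ubS : has_ubound S by exists b => t [/andP[]].
have supS : has_sup S by split => //; exists a.
pose T := sup S.
have leT t : S t -> t <= T by move=> St; apply: ub_le_sup.
have aT : a <= T by exact: leT.
have Tb : T <= b by apply: ge_sup; [exists a|move=> t [/andP[]]].
have Tab : a <= T <= b by rewrite aT.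
have VT : arclength T = u.
  apply/eqP; rewrite eq_le; apply/andP; split; rewrite leNgt; apply/negP => VT.
    have e0 : 0 < arclength T - u by rewrite subr_gt0.
    have [d d0 dT] := arclength_continuous Tab e0.
    have [t [tab Vt] Tt] := sup_adherent d0 supS.
    have tT : t <= T by apply: leT.
    have := dT _ tab; rewrite ler0_norm ?subr_le0// -/T in Tt *.
    by rewrite ltr_norml; lra.
  have e0 : 0 < u - arclength T by rewrite subr_gt0.
  have [d d0 dT] := arclength_continuous Tab e0.
  have Tb' : T < b.
    by rewrite lt_neqAle Tb andbT; apply/eqP => TE; move: VT; rewrite TE ltNge ub.
  pose t := Num.min b (T + d / 2).
  have Tt : T < t by rewrite lt_min Tb' ltrDl divr_gt0.
  have tab : a <= t <= b.
    by rewrite (le_trans aT (ltW Tt))/= /t ge_min lexx.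
  have tTd : t <= T + d / 2 by rewrite /t ge_min lexx orbT.
  have := dT _ tab; rewrite gtr0_norm ?subr_gt0//.
  move=> /(_ ltac:(lra)); rewrite ltr_norml => /andP[_ Vt].
  have St : S t by split => //; lra.
  by have := leT _ St; rewrite leNgt Tt.
have maxT t : a <= t <= b -> arclength t = u -> t <= T.
  by move=> tab Vt; apply: leT; split => //; rewrite Vt.
exists T; split => //.
apply/eqP; rewrite eq_le; apply/andP; split.
  apply: ge_sup; first by exists T; split => //; rewrite -arclengthK// VT.
  move=> t [tab Vt]; apply: maxT => //.
  by apply: EFin_inj; rewrite arclengthK.
apply: ub_le_sup; first by exists b => t [/andP[]].
by split => //; rewrite -arclengthK// VT.
Qed.

End length_function.

(** * Arc length parametrization *)

Section unit_speed.
Context {R : realType} {X : metricType R}.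

Definition unit_speed (L : R) (sigma : R -> X) : Prop :=
  forall u v, 0 <= u -> u <= v -> v <= L -> mdist (sigma u) (sigma v) <= v - u.

Variables (L : R) (sigma : R -> X).
Hypothesis L0 : 0 <= L.
Hypothesis sigmaL : unit_speed L sigma.

Let clamp (u : R) : R := Num.max 0 (Num.min u L).

Let clamp_itv u : 0 <= clamp u <= L.
Proof. by rewrite /clamp le_max lexx ge_max L0 ge_min lexx orbT. Qed.

Let clampE u : 0 <= u <= L -> clamp u = u.
Proof. by move=> /andP[u0 uL]; rewrite /clamp min_l// max_r. Qed.

Let clamp_le u v : u <= v -> 0 <= clamp v - clamp u <= v - u.
Proof.
by move=> uv; rewrite /clamp /Num.max /Num.min; do ![case: ifPn]; lra.
Qed.

Let clamp_lipschitz u v : mdist (sigma (clamp u)) (sigma (clamp v)) <= `|u - v|.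
Proof.
wlog uv : u v / u <= v.
  move=> H; have [uv|/ltW vu] := leP u v; first exact: H.
  by rewrite metric_sym distrC; exact: H.
rewrite ler0_norm ?subr_le0// opprB.
have /andP[u0 uL] := clamp_itv u; have /andP[v0 vL] := clamp_itv v.
have /andP[cuv cuv'] := clamp_le uv.
by apply: le_trans cuv'; apply: sigmaL => //; rewrite -subr_ge0.
Qed.

Let clamp_continuous : continuous (sigma \o clamp).
Proof.
move=> t; apply/metricType_numDomainType.cvgrPdist_lt => e e0 /=.
apply/nbhs_ballP; exists e => //= s ts.
exact: le_lt_trans (clamp_lipschitz _ _) ts.
Qed.

(** Precomposing with the projection of the line onto [[0, L]] turns the
    integrand into a lower semicontinuous function on the whole line. *)
Lemma measurable_fun_unit_speed (g : X -> R) : LC X g ->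
  measurable_fun `[0, L] ((fun u => (g (sigma u))%:E) : R -> \bar R).
Proof.
move=> gL; apply: (@eq_measurable_fun _ _ _ _ _ (fun u => (g (sigma (clamp u)))%:E)).
  by move=> u; rewrite inE/= in_itv/= => /clampE ->.
apply: (@measurable_funS _ _ _ _ setT) => //.
apply: lower_semicontinuous_measurable => u a au.
have [V nV Va] := gL _ _ au.
by exists ((sigma \o clamp) @^-1` V); [exact: clamp_continuous|move=> y /Va].
Qed.

End unit_speed.

Section arclength_parametrization.
Context {R : realType} {X : metricType R}.
Variable c : curve X.
Let a := cstart c.
Let b := cend c.
Let ab : a <= b := cstart_le_cend c.

Lemma len_fin_num : len c \is a fin_num.
Proof.
by rewrite ge0_fin_numE; [exact: curve_rectifiable|exact: path_length_ge0].
Qed.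

Lemma fine_len_ge0 : 0 <= fine (len c).
Proof. by apply: fine_ge0; exact: path_length_ge0. Qed.

Lemma arclength_paramP u : 0 <= u <= fine (len c) ->
  exists T, [/\ a <= T <= b, arclength c a T = u & arclength_param c u = c T].
Proof.
move=> uL.
have [T [Tab VT _ supT]] :=
  arclength_last_time ab (@curve_continuous _ _ c) (curve_rectifiable c) uL.
by exists T; split => //; rewrite /arclength_param supT.
Qed.

Lemma arclength_param_unit_speed : unit_speed (fine (len c)) (arclength_param c).
Proof.
move=> u v u0 uv vL.
have [|S [/andP[aS Sb] VS ->]] := @arclength_paramP u.
  by rewrite u0 (le_trans uv).
have [|T [/andP[aT Tb] VT ->]] := @arclength_paramP v.
  by rewrite (le_trans u0).
have [ST|/ltW TS] := leP S T.
  by rewrite -VS -VT; exact: (mdist_le_arclength (curve_rectifiable c)).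
have := mdist_le_arclength (curve_rectifiable c) aT TS Sb.
rewrite metric_sym VS VT => /le_trans; apply.
by move: uv; lra.
Qed.

Lemma arclength_param0 : arclength_param c 0 = c a.
Proof.
have [|T [/andP[aT Tb] VT ->]] := @arclength_paramP 0.
  by rewrite lexx fine_len_ge0.
apply/esym/mdist_positivity/eqP; rewrite eq_le mdist_ge0 andbT.
have := mdist_le_arclength (curve_rectifiable c) (lexx a) aT Tb.
by rewrite VT arclength_start subr0.
Qed.

Lemma arclength_param_len : arclength_param c (fine (len c)) = c b.
Proof.
have [|T [/andP[aT Tb] VT ->]] := @arclength_paramP (fine (len c)).
  by rewrite lexx fine_len_ge0.
apply/mdist_positivity/eqP; rewrite eq_le mdist_ge0 andbT.
have := mdist_le_arclength (curve_rectifiable c) aT Tb (lexx b).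
by rewrite VT subrr.
Qed.

Lemma measurable_fun_arclength_param (g : X -> R) : LC X g ->
  measurable_fun `[0, fine (len c)] ((fun u => (g (arclength_param c u))%:E) : R -> \bar R).
Proof.
apply: measurable_fun_unit_speed; first exact: fine_len_ge0.
exact: arclength_param_unit_speed.
Qed.

Lemma curve_integral_le_len (g : X -> R) : LC X g ->
  (forall x, 0 <= g x <= 1) -> (curve_integral g c <= len c)%E.
Proof.
move=> gL g01.
apply: le_trans (_ : \int[lebesgue_measure]_(u in `[0%R, fine (len c)]) 1 <= _)%E.
  apply: ge0_le_integral => //.
  - by move=> u _; rewrite lee_fin; case/andP: (g01 (arclength_param c u)).
  - exact: measurable_fun_arclength_param.
  - by move=> u _; rewrite lee_fin; case/andP: (g01 (arclength_param c u)).
rewrite integral_cst//= mul1e lebesgue_measure_itv/= lte_fin.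
by case: ifPn => _; rewrite ?oppr0 ?adde0 ?fineK ?len_fin_num// path_length_ge0.
Qed.

End arclength_parametrization.

(** * Translation of Lebesgue measure *)

Section translation.
Context {R : realType}.
Local Notation leb := (@lebesgue_measure R).

Let measurable_translation (h : R) :
  measurable_fun setT ((fun u => u - h) : measurableTypeR R -> measurableTypeR R).
Proof. by apply: measurable_funB => //; exact: measurable_cst. Qed.

Lemma lebesgue_measure_translation (h : R) (A : set R) : measurable A ->
  pushforward leb ((fun u => u - h) : measurableTypeR R -> measurableTypeR R) A = leb A.
Proof.
move=> mA; apply/esym/lebesgue_measure_unique => //=.
move=> _ [[a b]] _ <-; rewrite /pushforward.
rewrite (_ : _ @^-1` _ = `]a + h, b + h]%classic); last first.
  by apply/seteqP; split => u /=; rewrite !in_itv/= ltrBrDr lerBlDr.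
rewrite !lebesgue_measure_itv/= !lte_fin ltrD2r; case: ifPn => // _.
by rewrite -!EFinB; congr EFin; lra.
Qed.

(** The second half of a concatenation is run through with a delay, the length
    of the first half. *)
Lemma ge0_integral_translation (h L : R) (F : R -> \bar R) :
  measurable_fun `[0, L] F -> (forall u, 0 <= F u)%E ->
  (\int[leb]_(u in `[h, (h + L)%R]) F (u - h)%R = \int[leb]_(u in `[0%R, L]) F u)%E.
Proof.
move=> mF F0.
have -> : `[h, h + L]%classic =
    ((fun u => u - h) : measurableTypeR R -> measurableTypeR R) @^-1` `[0, L].
  apply/seteqP; split => u /=; rewrite !in_itv/= => /andP[? ?];
  by apply/andP; split; lra.
have := @ge0_integral_pushforward _ _ _ _ _ _ (measurable_translation h) leb
  `[0%R, L]%classic F _ mF (fun u _ => F0 u).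
move=> /(_ (measurable_itv _)) /= <-.
by apply: eq_measure_integral => //= A mA AS; exact: lebesgue_measure_translation.
Qed.

End translation.

(** * Concatenation of curves *)

Section path_length_transport.
Context {R : realType} {X : metricType R}.

Lemma path_length_congr (f g : R -> X) (a b : R) :
  (forall t, a <= t <= b -> f t = g t) -> path_length f a b = path_length g a b.
Proof.
move=> fg; rewrite /path_length; congr ereal_sup.
apply/eq_imagel => P abP; congr EFin.
elim: P a abP fg => [|x P IH] a abP fg; first by rewrite /= !big_nil.
have xbP := itv_partition_cons abP; have xb := itv_partition_le xbP.
have [/= /andP[ax _] _] := abP.
rewrite /= !big_cons/= !fg ?lexx ?(ltW ax) ?xb//; last first.
  exact: le_trans (ltW ax) xb.
congr (_ + _); apply: IH => // t /andP[xt tb].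
by rewrite fg// tb (le_trans (ltW ax)).
Qed.

Let path_length_shift_le (f : R -> X) (h a b : R) :
  (path_length (fun t => f (t + h)%R) a b <= path_length f (a + h)%R (b + h)%R)%E.
Proof.
apply: ge_ereal_sup => _ [P [aP /eqP lP] <-].
apply: ereal_sup_ubound; exists [seq t + h | t <- P].
  split; last by rewrite (last_map (fun t => t + h)) lP.
  by elim: P a aP {lP} => //= x P IH a /andP[ax /IH ->]; rewrite ltrD2r ax.
congr EFin; elim: P a {aP lP} => [|x P IH] a; first by rewrite /= !big_nil.
by rewrite /= !big_cons/=; congr (_ + _); exact: IH.
Qed.

Lemma path_length_shift (f : R -> X) (h a b : R) :
  path_length (fun t => f (t + h)) a b = path_length f (a + h) (b + h).
Proof.
apply/eqP; rewrite eq_le path_length_shift_le/=.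
have := path_length_shift_le (fun t => f (t + h)) (- h) (a + h) (b + h).
rewrite !addrK; apply: le_trans; rewrite le_eqVlt; apply/orP; left; apply/eqP.
by apply: path_length_congr => t _; rewrite subrK.
Qed.

End path_length_transport.

Section concatenation.
Context {R : realType} {X : metricType R}.
Variables c1 c2 : curve X.
Hypothesis c12 : c1 (cend c1) = c2 (cstart c2).

Local Notation a1 := (cstart c1).
Local Notation b1 := (cend c1).
Local Notation a2 := (cstart c2).
Local Notation b2 := (cend c2).
Let B := b1 + (b2 - a2).
Let L1 := fine (len c1).
Let L2 := fine (len c2).
Let ab1 := cstart_le_cend c1.
Let ab2 := cstart_le_cend c2.

Let f (t : R) : X := if t <= b1 then c1 t else c2 (t - b1 + a2).

Let f1 t : t <= b1 -> f t = c1 t. Proof. by rewrite /f => ->. Qed.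

Let f2 t : b1 <= t -> f t = c2 (t - b1 + a2).
Proof.
rewrite /f; have [tb1 b1t|//] := leP t b1.
have -> : t = b1 by apply/eqP; rewrite eq_le tb1.
by rewrite c12 subrr add0r.
Qed.

Let aB : a1 <= B.
Proof. by rewrite /B; have := ab1; have := ab2; lra. Qed.

Let length1 t : t <= b1 -> path_length f a1 t = path_length c1 a1 t.
Proof.
by move=> tb; apply: path_length_congr => s /andP[_ st]; rewrite f1// (le_trans st).
Qed.

Let length2 t : b1 <= t -> path_length f a1 t =
  (len c1 + path_length c2 a2 (t - b1 + a2)%R)%E.
Proof.
move=> bt; rewrite (path_length_cat _ ab1 bt) length1//; congr (_ + _)%E.
rewrite -[RHS](_ : path_length (fun s => c2 (s + (a2 - b1))) b1 t = _).
  by apply: path_length_congr => s /andP[b1s _]; rewrite f2//; congr (c2 _); lra.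
by rewrite path_length_shift; congr path_length; lra.
Qed.

Let lengthB : path_length f a1 B = (len c1 + len c2)%E.
Proof.
have b1B : b1 <= B by rewrite /B lerDl subr_ge0.
by rewrite length2//; congr (_ + path_length _ _ _)%E; rewrite /B; lra.
Qed.

Let f_rectifiable : (path_length f a1 B < +oo)%E.
Proof. by rewrite lengthB lte_add_pinfty ?curve_rectifiable. Qed.

Let f_continuous : {within `[a1, B], continuous f}.
Proof.
have cc1 := (within_continuous_mdistP _ _ _).1 (@curve_continuous _ _ c1).
have cc2 := (within_continuous_mdistP _ _ _).1 (@curve_continuous _ _ c2).
have left t0 e : a1 <= t0 <= b1 -> 0 < e -> exists2 d : R, 0 < d &
    forall t, a1 <= t <= b1 -> `|t - t0| < d -> mdist (f t0) (f t) < e.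
  move=> t0ab e0; have [d d0 cd] := cc1 _ t0ab _ e0; exists d => // t tab td.
  have /andP[_ ?] := tab; have /andP[_ ?] := t0ab.
  by rewrite !f1//; exact: cd.
have right t0 e : b1 <= t0 <= B -> 0 < e -> exists2 d : R, 0 < d &
    forall t, b1 <= t <= B -> `|t - t0| < d -> mdist (f t0) (f t) < e.
  move=> /andP[bt0 t0B] e0.
  have sB t : t <= B -> t - b1 + a2 <= b2 by rewrite /B; lra.
  have [|d d0 cd] := cc2 (t0 - b1 + a2) _ _ e0; first by rewrite sB//; lra.
  exists d => // t /andP[bt tB] td.
  rewrite !f2//; apply: cd; first by rewrite sB//; lra.
  by rewrite (_ : _ - _ = t - t0)//; lra.
apply/within_continuous_mdistP => t0 /andP[at0 t0B] e e0.
have [t0b|bt0|t0b] := ltgtP t0 b1.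
- have [|d d0 ld] := left t0 _ _ e0; first by rewrite at0 ltW.
  exists (Num.min d (b1 - t0)); first by rewrite lt_min d0 subr_gt0.
  move=> t /andP[at_ _]; rewrite lt_min => /andP[td]; rewrite ltr_norml => tb.
  by apply: ld => //; rewrite at_/=; move: tb; lra.
- have [|d d0 rd] := right t0 _ _ e0; first by rewrite t0B ltW.
  exists (Num.min d (t0 - b1)); first by rewrite lt_min d0 subr_gt0.
  move=> t /andP[_ tB]; rewrite lt_min => /andP[td]; rewrite ltr_norml => tb.
  by apply: rd => //; rewrite tB andbT; move: tb; lra.
- have [|d d0 ld] := left t0 _ _ e0; first by rewrite at0 t0b lexx.
  have [|d' d'0 rd] := right t0 _ _ e0; first by rewrite t0B t0b lexx.
  exists (Num.min d d'); first by rewrite lt_min d0.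
  move=> t /andP[at_ tB]; rewrite lt_min => /andP[td td'].
  by have [tb1|/ltW bt] := leP t b1; [apply: ld|apply: rd]; rewrite // ?at_ ?tB ?andbT.
Qed.

Definition concat : curve X := Curve aB f_continuous f_rectifiable.

Lemma concat_start : concat (cstart concat) = c1 a1.
Proof. by rewrite /= f1. Qed.

Lemma concat_end : concat (cend concat) = c2 b2.
Proof.
rewrite /= f2; first by congr (c2 _); rewrite /B; lra.
by rewrite /B lerDl subr_ge0.
Qed.

Lemma len_concat : len concat = (len c1 + len c2)%E.
Proof. exact: lengthB. Qed.

(** Lengths add up, so the times at which the concatenation has run through the
    length [u] are those of the first curve as long as [u < L1], and those of
    the second curve for the length [u - L1] afterwards. *)
Lemma arclength_param_concat1 u : 0 <= u < L1 ->
  arclength_param concat u = arclength_param c1 u.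
Proof.
move=> /andP[u0 uL].
have uL1 : 0 <= u <= L1 by rewrite u0 ltW.
have [T [/andP[aT Tb] VT _ supT]] :=
  arclength_last_time ab1 (@curve_continuous _ _ c1) (curve_rectifiable c1) uL1.
rewrite /arclength_param/= -[in RHS]/(f _).
rewrite (_ : [set t | _ /\ path_length f _ _ = _] =
  [set t | a1 <= t <= b1 /\ path_length c1 a1 t = u%:E]) ?supT ?f1//.
apply/seteqP; split=> t /= [/andP[at_ tb] Vt].
  have [tb1|b1t] := leP t b1; first by rewrite at_ -length1.
  move: Vt; rewrite (length2 (ltW b1t)) => Vt; exfalso.
  have : (len c1 <= u%:E)%E.
    by rewrite -Vt leeDl// path_length_ge0//; move: b1t; lra.
  by rewrite -(fineK (len_fin_num c1)) lee_fin leNgt uL.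
have b1B : b1 <= B by rewrite /B lerDl subr_ge0.
by rewrite at_ length1// (le_trans tb b1B).
Qed.

Lemma arclength_param_concat2 u : L1 <= u <= L1 + L2 ->
  arclength_param concat u = arclength_param c2 (u - L1).
Proof.
move=> uL.
have uL2 : 0 <= u - L1 <= L2 by move: uL; lra.
have [T [/andP[aT Tb] VT maxT supT]] :=
  arclength_last_time ab2 (@curve_continuous _ _ c2) (curve_rectifiable c2) uL2.
rewrite /arclength_param/= supT.
have VTE : path_length c2 a2 T = (u - L1)%:E.
  by rewrite -VT (arclengthK (curve_rectifiable c2))// aT.
pose S := T - a2 + b1.
have bS : b1 <= S by rewrite /S lerDr subr_ge0.
have SE : S - b1 + a2 = T by rewrite /S; lra.
suff -> : sup [set t | a1 <= t <= B /\ path_length f a1 t = u%:E] = S.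
  by rewrite f2// SE.
have SS : a1 <= S <= B /\ path_length f a1 S = u%:E.
  split; first by rewrite (le_trans ab1)//= /S /B; move: Tb; lra.
  rewrite length2// SE VTE -(fineK (len_fin_num c1)) -EFinD.
  by congr EFin; rewrite /L1; lra.
have ubS t : a1 <= t <= B /\ path_length f a1 t = u%:E -> t <= S.
  move=> [/andP[at_ tB] Vt]; have [tb1|/ltW b1t] := leP t b1.
    exact: le_trans bS.
  suff : t - b1 + a2 <= T by rewrite /S; lra.
  have tab : a2 <= t - b1 + a2 <= b2 by move: b1t tB; rewrite /B; lra.
  apply: maxT => //; apply: EFin_inj.
  rewrite (arclengthK (curve_rectifiable c2))//.
  move: Vt; rewrite length2// EFinB => <-.
  by rewrite -(fineK (len_fin_num c1)) [X in (X - _)%E]addeC addeK.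
apply/eqP; rewrite eq_le; apply/andP; split.
  by apply: ge_sup; [exists S|].
by apply: ub_le_sup => //; exists S.
Qed.

(** The arc length parametrizations agree with those of the two halves on
    adjacent intervals. *)
Lemma curve_integral_concat (g : X -> R) : LC X g -> (forall x, 0 <= g x) ->
  (curve_integral g concat <= curve_integral g c1 + curve_integral g c2)%E.
Proof.
move=> gL g0; have L10 : 0 <= L1 := fine_len_ge0 c1.
have L20 : 0 <= L2 := fine_len_ge0 c2.
have LE : fine (len concat) = L1 + L2.
  by rewrite len_concat fineD// len_fin_num.
have mg := measurable_fun_arclength_param (c := concat) gL.
rewrite LE in mg.
have itvE : `[0, L1 + L2]%classic = `[0, L1[ `|` `[L1, L1 + L2].
  apply/seteqP; split => u /=; rewrite !in_itv/=.
    by move=> /andP[u0 uL]; have [?|?] := ltP u L1; [left|right]; rewrite ?u0.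
  by case=> /andP[? ?]; apply/andP; split; lra.
rewrite /curve_integral LE itvE ge0_integral_setU//=; last 3 first.
- by rewrite -itvE.
- by move=> u _; rewrite lee_fin.
- apply/disj_setPS => u /= [] /=; rewrite !in_itv/= => /andP[_ uL] /andP[Lu _].
  by move: uL; rewrite ltNge Lu.
apply: leeD.
  rewrite [leLHS](_ : _ = \int[lebesgue_measure]_(u in `[0%R, L1[)
      (g (arclength_param c1 u))%:E)%E; last first.
    by apply: eq_integral => u; rewrite inE/= in_itv/= => uL; rewrite -arclength_param_concat1.
  apply: ge0_subset_integral => //=.
  - exact: measurable_fun_arclength_param.
  - by move=> u _; rewrite lee_fin.
  - by move=> u /=; rewrite !in_itv/= => /andP[-> /ltW].
rewrite [leLHS](_ : _ = \int[lebesgue_measure]_(u in `[L1, (L1 + L2)%R])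
    (g (arclength_param c2 (u - L1)%R))%:E)%E; last first.
  by apply: eq_integral => u; rewrite inE/= in_itv/= => uL; rewrite -arclength_param_concat2.
rewrite (ge0_integral_translation L1 (measurable_fun_arclength_param (c := c2) gL))//.
by move=> u; rewrite lee_fin.
Qed.

End concatenation.

(** * Vitali covering in a metric space *)

Section covering.
Context {R : realType} {X : metricType R}.

(** Zorn replaces the usual greedy choice: among disjoint subfamilies [G] such
    that a ball of [F] meeting [G] meets a ball of [G] at least half as large,
    a maximal one meets every ball of [F], for otherwise a nearly largest ball
    missing [G] could be added. *)
Lemma vitali_covering (F : set (X * R)) (S : R) :
  (forall b, F b -> 0 < b.2 <= S) ->
  exists G : set (X * R), [/\ G `<=` F, trivIset G (fun b => ball b.1 b.2) &
    forall b, F b -> exists2 b', G b' & ball b.1 b.2 `<=` ball b'.1 (5 * b'.2)].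
Proof.
move=> FS; pose meets (b b' : X * R) := ball b.1 b.2 `&` ball b'.1 b'.2 !=set0.
pose P (G : set (X * R)) := [/\ G `<=` F, trivIset G (fun b => ball b.1 b.2) &
  forall b b', F b -> G b' -> meets b b' ->
    exists b'', [/\ G b'', meets b b'' & b.2 <= 2 * b''.2]].
have [|G [[GF tG nearG] maxG]] := @Zorn_bigcup _ P.
  move=> C CP totC; split.
  - by move=> b [G /CP[GF _ _]] /GF.
  - move=> b b' [G CG Gb] [G' CG' Gb'] bb'.
    have [GG'|G'G] := totC _ _ CG CG'.
      by have [_ tG _] := CP _ CG'; apply: tG => //; exact: GG'.
    by have [_ tG _] := CP _ CG; apply: tG => //; exact: G'G.
  - move=> b b' Fb [G CG Gb'] bb'; have [_ _ nearG] := CP _ CG.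
    by have [b'' [Gb'' ? ?]] := nearG _ _ Fb Gb' bb'; exists b''; split => //; exists G.
have meetG b : F b -> exists2 b', G b' & meets b b'.
  move=> Fb; apply: contrapT => Gb.
  pose T := [set r | exists2 b', F b' /\ b'.2 = r &
    forall b'', G b'' -> ~ meets b' b''].
  have Tb : T b.2.
    by exists b => // b'' Gb'' bb''; apply: Gb; exists b''.
  have ubT : has_ubound T by exists S => _ [b' [/FS/andP[_ ?] <-]].
  have supT : has_sup T by split => //; exists b.2.
  have supT0 : 0 < sup T.
    by apply: (@lt_le_trans _ _ b.2); [case/andP: (FS _ Fb)|exact: ub_le_sup].
  have [|r [b0 [Fb0 b0r] Gb0] Tr] := @sup_adherent _ T (sup T / 2) _ supT.
    by rewrite divr_gt0.
  have b0G : ~ G b0.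
    move=> Gb0'; apply: (Gb0 _ Gb0'); exists b0.1; split;
    by apply: ballxx; case/andP: (FS _ Fb0).
  apply: (maxG (G `|` [set b0])).
    split; first by move=> b' ?; left.
    by move=> /(_ b0 (or_intror erefl)).
  split.
  - by move=> b' [/GF//|->].
  - move=> b1 b2 [Gb1|->] [Gb2|->] bb.
    + exact: tG.
    + by exfalso; apply: (Gb0 _ Gb1); case: bb => z [? ?]; exists z.
    + by exfalso; exact: (Gb0 _ Gb2).
    + by [].
  - move=> b1 b2 Fb1 Gb2 bb.
    have [[b3 Gb3 b13]|no] := pselect (exists2 b3, G b3 & meets b1 b3).
      by have [b4 [? ? ?]] := nearG _ _ Fb1 Gb3 b13; exists b4; split => //; left.
    exists b0; split; first by right.
      by case: Gb2 => [Gb2|<-//]; exfalso; apply: no; exists b2.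
    have : b1.2 <= sup T.
      apply: ub_le_sup => //; exists b1 => // b'' Gb'' bb''.
      by apply: no; exists b''.
    by move: Tr; rewrite b0r; lra.
exists G; split => // b Fb.
have [b' Gb' bb'] := meetG _ Fb.
have [b'' [Gb'' [z [bz b''z]] bb'']] := nearG _ _ Fb Gb' bb'.
exists b'' => // y; move: bz b''z; rewrite !ballEmdist /= => bz b''z by_.
have := metric_triangle b''.1 z y; have := metric_triangle z b.1 y.
by rewrite (metric_sym z b.1); lra.
Qed.

End covering.

Section disjoint_families.
Context {R : realType} {d : measure_display} {T : measurableType d}.
Variable mu : {measure set T -> \bar R}.
Local Open Scope ereal_scope.

(** At most [(n + 1) * mu A] of the sets have measure above [1 / (n + 1)]. *)
Lemma trivIset_measure_gt0_countable (I : choiceType) (B : I -> set T) (G : set I)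
    (A : set T) : measurable A -> mu A < +oo ->
  (forall i, G i -> [/\ measurable (B i), B i `<=` A & 0 < mu (B i)]) ->
  trivIset G B -> countable G.
Proof.
move=> mA Aoo GB tB.
rewrite (_ : G = \bigcup_n [set i | G i /\ (n.+1%:R^-1)%:E < mu (B i)]); last first.
  apply/seteqP; split => [i Gi|i [n _] []//].
  have [mB BA B0] := GB _ Gi.
  have Bfin : mu (B i) \is a fin_num.
    rewrite ge0_fin_numE ?measure_ge0//; apply: le_lt_trans Aoo.
    by apply: le_measure => //; rewrite inE.
  have /ltr_add_invr[k] : (0 < fine (mu (B i)))%R.
    by rewrite -lte_fin fineK.
  by rewrite add0r => kB; exists k => //; split => //; rewrite -(fineK Bfin) lte_fin.
apply: bigcup_countable => // n _; apply: finite_set_countable.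
apply: contrapT => infG.
pose m := (Num.truncn ((n.+1%:R * fine (mu A)))).+1.
have [D DG mD] := infinite_set_fset m infG.
have Afin : mu A \is a fin_num by rewrite ge0_fin_numE ?measure_ge0.
have : mu (\bigcup_(i in [set` D]) B i) <= mu A.
  apply: le_measure; rewrite ?inE//.
    by apply: fin_bigcup_measurable => // i /DG[/GB[]].
  by apply: bigcup_sub => i /DG[/GB[]].
rewrite bigcup_fset measure_fbigsetU//; last 2 first.
  by move=> i /DG[/GB[]].
  by move=> i j /DG[Gi _] /DG[Gj _]; exact: tB.
rewrite leNgt => /negP; apply.
apply: (@lt_le_trans _ _ (\sum_(i <- D) (n.+1%:R^-1)%:E)); last first.
  rewrite big_seq [leRHS]big_seq; apply: lee_sum => i /DG[_ /ltW].
  by [].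
rewrite -(fineK Afin) sumEFin lte_fin big_const_seq count_predT iter_addr addr0.
rewrite -[ltRHS]mulr_natl ltr_pdivlMr// mulrC (lt_le_trans (truncnS_gt _))//.
by rewrite ler_nat.
Qed.

End disjoint_families.

(** * Borel measurability *)

Section borel_measurability.
Context {R : realType} {d : measure_display} {X : metricMeasurableType R d}.
Hypothesis borelX : borel X `<=` (measurable : set_system X).

Lemma open_measurable_metric (A : set X) : open A -> measurable A.
Proof. by move=> oA; apply: borelX; apply: sub_sigma_algebra. Qed.

Lemma open_metric_ball (x : X) (r : R) : open (ball x r).
Proof.
rewrite openE => y; rewrite ballEmdist /= => xy.
apply/nbhs_ballP; exists (r - mdist x y) => /=; first by rewrite subr_gt0.
move=> z; rewrite !ballEmdist /= => yz.
by have := metric_triangle x y z; lra.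
Qed.

Lemma measurable_metric_ball (x : X) (r : R) : measurable (ball x r).
Proof. exact/open_measurable_metric/open_metric_ball. Qed.

Lemma measurable_borel_function (f : X -> R) : borel_function f ->
  measurable_fun setT f.
Proof.
move=> mf _ B mB; have := mf measurableT B mB.
by rewrite !setTI => /borelX.
Qed.

Lemma measurable_LC (g : X -> R) : LC X g -> measurable_fun setT g.
Proof.
move=> gL; apply: (measurability _ (RGenOInfty.measurableE R)).
move=> _ [_ [a ->]] <-; rewrite setTI; apply: open_measurable_metric.
have /lower_semicontinuousP/(_ a) := gL.
rewrite (_ : [set x | _] = g @^-1` `]a, +oo[)//.
by apply/seteqP; split => x /=; rewrite in_itv/= andbT lte_fin.
Qed.

End borel_measurability.

(** * Integrals over covered sets *)

Section vitali_integral.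
Context {R : realType} {d : measure_display} {X : metricMeasurableType R d}.
Variable mu : {measure set X -> \bar R}.
Hypothesis borelX : borel X `<=` (measurable : set_system X).
Local Open Scope ereal_scope.

Lemma ge0_integral_bigcup_le (D : nat -> set X) (f : X -> R) :
  (forall n, measurable (D n)) -> measurable_fun setT f ->
  (forall x, (0 <= f x)%R) ->
  \int[mu]_(x in \bigcup_n D n) (f x)%:E <=
  \sum_(0 <= n <oo) \int[mu]_(x in D n) (f x)%:E.
Proof.
move=> mD mf f0.
have mfE A : measurable_fun A (EFin \o f).
  by apply/measurable_EFinP; exact: measurable_funS mf.
have mS n : measurable (seqDU D n) by apply: seqDU_measurable.
rewrite seqDU_bigcup_eq ge0_integral_bigcup//; last first.
  by move=> x _; rewrite lee_fin.
apply: lee_nneseries => [n _ _|n _]; first by apply: integral_ge0 => x _; rewrite lee_fin.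
apply: ge0_subset_integral => //; first by move=> x _; rewrite lee_fin.
exact: subset_seqDU.
Qed.

(** The countably many balls selected by the covering lemma are disjoint, and
    their fivefold dilations cover. *)
Lemma vitali_integral_le (F : set (X * R)) (S c : R) (A E : set X)
    (v f : X -> R) :
  measurable_fun setT v -> (forall x, (0 <= v x)%R) ->
  measurable_fun setT f -> (forall x, (0 <= f x)%R) ->
  (0 <= c)%R -> measurable A -> mu A < +oo -> measurable E ->
  E `<=` \bigcup_(b in F) ball b.1 b.2 ->
  (forall b, F b -> [/\ (0 < b.2 <= S)%R, ball b.1 b.2 `<=` A,
    0 < mu (ball b.1 b.2) &
    \int[mu]_(x in ball b.1 (5 * b.2)%R) (v x)%:E <=
      c%:E * \int[mu]_(x in ball b.1 b.2) (f x)%:E]) ->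
  \int[mu]_(x in E) (v x)%:E <= c%:E * \int[mu]_(x in A) (f x)%:E.
Proof.
move=> mv v0 mf f0 c0 mA Aoo mE EF Fb.
have mball x r : measurable (ball x r) := measurable_metric_ball borelX x r.
have mvE B : measurable_fun B (EFin \o v).
  by apply/measurable_EFinP; exact: measurable_funS mv.
have mfE B : measurable_fun B (EFin \o f).
  by apply/measurable_EFinP; exact: measurable_funS mf.
have [|G [GF tG coverG]] := @vitali_covering _ _ F S; first by move=> b /Fb[].
have /countable_injP[h hinj] : countable G.
  apply: (trivIset_measure_gt0_countable mA Aoo _ tG) => b /GF/Fb[_ bA b0 _].
  by split => //; exact: mball.
(* A total indexing by nat, through empty sets where no ball has index n. *)
pose I n := [set b | G b /\ h b = n].
pose B n := \bigcup_(b in I n) ball b.1 b.2.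
pose B5 n := \bigcup_(b in I n) ball b.1 (5 * b.2)%R.
have IE n : I n = set0 \/ exists2 b, G b & I n = [set b].
  have [[b [Gb hb]]|no] := pselect (exists b, G b /\ h b = n); last first.
    by left; apply/seteqP; split => // b [Gb hb]; apply: no; exists b.
  right; exists b => //; apply/seteqP; split=> [b' [Gb' hb']|_ ->//].
  by apply: hinj; rewrite ?inE// hb.
have mB n : measurable (B n).
  by rewrite /B; case: (IE n) => [->|[b _ ->]]; rewrite ?bigcup_set0// bigcup_set1.
have mB5 n : measurable (B5 n).
  by rewrite /B5; case: (IE n) => [->|[b _ ->]]; rewrite ?bigcup_set0// bigcup_set1.
have tB : trivIset setT B.
  move=> m n _ _ [x [[b [Gb hb] bx] [b' [Gb' hb'] b'x]]].
  by rewrite -hb -hb'; congr h; apply: tG => //; exists x.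
have BA : \bigcup_n B n `<=` A.
  by apply: bigcup_sub => n _; apply: bigcup_sub => b [/GF/Fb[]].
have EB5 : E `<=` \bigcup_n B5 n.
  move=> x /EF[b /coverG[b' Gb' bb'] bx].
  by exists (h b') => //; exists b' => //; exact: bb'.
apply: (@le_trans _ _ (\int[mu]_(x in \bigcup_n B5 n) (v x)%:E)).
  apply: ge0_subset_integral => //; last by move=> x _; rewrite lee_fin.
  by apply: bigcup_measurable => n _.
apply: le_trans (ge0_integral_bigcup_le mB5 mv v0) _.
apply: (@le_trans _ _ (c%:E * \int[mu]_(x in \bigcup_n B n) (f x)%:E)); last first.
  rewrite lee_wpmul2l ?lee_fin//; apply: ge0_subset_integral => //.
    by apply: bigcup_measurable => n _.
  by move=> x _; rewrite lee_fin.
rewrite ge0_integral_bigcup//; last by move=> x _; rewrite lee_fin.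
rewrite -nneseriesZl//; last first.
  by move=> n _; apply: integral_ge0 => x _; rewrite lee_fin.
apply: lee_nneseries => [n _ _|n _]; first by apply: integral_ge0 => x _; rewrite lee_fin.
rewrite /B5 /B; case: (IE n) => [->|[b /GF/Fb[_ _ _ bv] ->]].
  by rewrite !bigcup_set0 !integral_set0 mule0.
by rewrite !bigcup_set1.
Qed.

End vitali_integral.

(** * Maximal functions through integrals over balls *)

Section maximal_functions.
Context {R : realType} {d : measure_display} {X : metricMeasurableType R d}.
Variables (mu : {measure set X -> \bar R}) (Omega : set X) (w : X -> R).
Hypothesis w_ge0 : forall x, 0 <= w x.
Hypothesis w_fin : forall (x : X) (r : R), 0 < r ->
  (weight_of mu w (ball x r) < +oo)%E.

Definition power_integral (q : R) (g : X -> R) (x : X) (r : R) : \bar R :=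
  \int[mu]_(y in ball x r) (`|g y| `^ q * w y)%:E.

Lemma power_integral_ge0 q g x r : (0 <= power_integral q g x r)%E.
Proof. by apply: integral_ge0 => y _; rewrite lee_fin mulr_ge0 ?powR_ge0. Qed.

Lemma weight_ge0 A : (0 <= weight_of mu w A)%E.
Proof. by apply: integral_ge0 => y _; rewrite lee_fin. Qed.

Lemma ball_mean_le q g x r t : 0 < q -> 0 <= t -> 0 < r ->
  (0 < weight_of mu w (ball x r))%E ->
  (ball_mean mu q w g x r <= t%:E)%E <->
  (power_integral q g x r <= (t `^ q)%:E * weight_of mu w (ball x r))%E.
Proof.
move=> q0 t0 r0 W0; rewrite /ball_mean -/(power_integral q g x r).
have Wfin : weight_of mu w (ball x r) \is a fin_num.
  by rewrite ge0_fin_numE ?w_fin// weight_ge0.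
have W0' : 0 < fine (weight_of mu w (ball x r)) by rewrite -lte_fin fineK.
rewrite -(fineK Wfin) inver gt_eqF// -lee_pdivrMr//.
set s := (_ * _)%E.
have s0 : (0 <= s)%E.
  by apply: mule_ge0; [exact: power_integral_ge0|rewrite lee_fin invr_ge0 ltW].
have qV : q * q^-1 = 1 by rewrite divff ?gt_eqF.
have Vq : q^-1 * q = 1 by rewrite mulrC.
have nng (u : \bar R) : (0 <= u)%E -> u \in `[0%E, +oo%E].
  by move=> u0; rewrite in_itv/= u0 leey.
split => H.
  have := @gt0_ler_poweR _ _ (ltW q0) _ _ (nng _ (poweR_ge0 s q^-1))
    (nng t%:E t0) H.
  by rewrite -poweRrM Vq poweRe1// poweR_EFin.
have qi : 0 <= q^-1 by rewrite invr_ge0 ltW.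
have tq0 : (0 <= (t `^ q)%:E)%E by rewrite lee_fin powR_ge0.
have := @gt0_ler_poweR _ _ qi _ _ (nng _ s0) (nng _ tq0) H.
by rewrite poweR_EFin -powRrM qV powRr1.
Qed.

Lemma sup_ball_mean_le q g x t (P : R -> bool) :
  0 < q -> 0 <= t -> (forall r, P r -> 0 < r) ->
  (forall r, P r -> 0 < weight_of mu w (ball x r))%E ->
  (ereal_sup (0%E |` [set ball_mean mu q w g x r | r in [set r | P r]]) <=
     t%:E)%E <->
  (forall r, P r -> power_integral q g x r <=
     (t `^ q)%:E * weight_of mu w (ball x r))%E.
Proof.
move=> q0 t0 P0 W0; split => [H r Pr|H].
  apply/ball_mean_le => //; [exact: P0|exact: W0|].
  by apply: le_trans H; apply: ereal_sup_ubound; right; exists r.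
apply: ge_ereal_sup => _ [->|[r Pr <-]]; first by rewrite lee_fin.
by apply/ball_mean_le; [exact: q0|exact: t0|exact: P0|exact: W0|exact: H].
Qed.

Hypothesis w_gt0 : forall x r, Omega x -> 0 < r ->
  (0 < weight_of mu w (ball x r))%E.

Lemma maximal_le q kappa g x t : 0 < q -> 0 <= t -> Omega x ->
  (maximal mu Omega q w kappa g x <= t%:E)%E <->
  (forall r, 0 < r < kappa * dist_set x (~` Omega) ->
     (power_integral q g x r <= (t `^ q)%:E * weight_of mu w (ball x r))%E).
Proof.
move=> q0 t0 Ox.
apply: (@sup_ball_mean_le _ _ _ _ (fun r => 0 < r < _)) => // r /andP[r0 _]//.
exact: w_gt0.
Qed.

Lemma maximal_restr_le q kappa rho g x t : 0 < q -> 0 <= t -> Omega x ->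
  (maximal_restr mu Omega q w kappa rho g x <= t%:E)%E <->
  (forall r, 0 < r < Num.min (kappa * dist_set x (~` Omega)) rho ->
     (power_integral q g x r <= (t `^ q)%:E * weight_of mu w (ball x r))%E).
Proof.
move=> q0 t0 Ox.
apply: (@sup_ball_mean_le _ _ _ _ (fun r => 0 < r < _)) => // r /andP[r0 _]//.
exact: w_gt0.
Qed.

End maximal_functions.

(** * Distance to a set *)

Section distance.
Context {R : realType} {X : metricType R}.
Implicit Types (x y : X) (E : set X).

Lemma dist_set_le x y E : E y -> dist_set x E <= mdist x y.
Proof.
move=> Ey; apply: ge_inf; last by exists y.
by exists 0 => _ [z _ <-]; exact: mdist_ge0.
Qed.

Lemma dist_set_gt0 x (O : set X) : open O -> O x -> ~` O !=set0 ->
  0 < dist_set x (~` O).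
Proof.
move=> oO Ox [z Oz]; have /nbhs_ballP[e /= e0 eO] : nbhs x O by exact: open_nbhs_nbhs.
apply: (lt_le_trans e0); apply: lb_le_inf; first by exists (mdist x z), z.
move=> _ [v Ov <-]; rewrite leNgt; apply/negP => xv; apply: Ov; apply: eO.
by rewrite ballEmdist.
Qed.

Lemma dist_set_adherent x E (e : R) : E !=set0 -> 0 < e ->
  exists2 y, E y & mdist x y < dist_set x E + e.
Proof.
move=> [z Ez] e0.
have [|_ [y Ey <-] ye] := @inf_adherent _ [set mdist x y | y in E] _ e0.
  by split; [exists (mdist x z), z|exists 0 => _ [v _ <-]; exact: mdist_ge0].
by exists y.
Qed.

End distance.

(** * Weak type bound on the superlevel sets *)

Section level_sets.
Context {R : realType} {d : measure_display} {X : metricMeasurableType R d}.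
Variables (mu : {measure set X -> \bar R}) (Omega : set X) (w : X -> R).
Hypothesis borelX : borel X `<=` (measurable : set_system X).
Hypothesis mu_ball : forall (x : X) r, 0 < r -> (0 < mu (ball x r) < +oo)%E.
Hypothesis w_meas : measurable_fun setT w.
Hypothesis w_ge0 : forall x, 0 <= w x.

Local Notation dOmega x := (dist_set x (~` Omega)).
Local Notation W x r := (weight_of mu w (ball x r)).

Lemma measurable_weighted_power q g : LC X g ->
  measurable_fun setT (fun y => `|g y| `^ q * w y).
Proof.
move=> gL; apply: measurable_funM => //.
apply: (@measurableT_comp _ _ _ _ _ _ (fun u : R => u `^ q)).
  exact: measurable_powR.
by apply: measurableT_comp => //; exact: measurable_LC borelX _ gL.
Qed.

Lemma weighted_power_ge0 q (g : X -> R) y : 0 <= `|g y| `^ q * w y.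
Proof. by rewrite mulr_ge0 ?powR_ge0. Qed.

Lemma integral_subset_le (f : X -> R) (A B : set X) : measurable_fun setT f ->
  (forall y, 0 <= f y) -> measurable A -> measurable B -> A `<=` B ->
  (\int[mu]_(y in A) (f y)%:E <= \int[mu]_(y in B) (f y)%:E)%E.
Proof.
move=> mf f0 mA mB AB; apply: ge0_subset_integral => //; last first.
  by move=> y _; rewrite lee_fin.
by apply/measurable_EFinP; exact: measurable_funS mf.
Qed.

Lemma weight_ball_le x r y s : mdist x y + r <= s -> (W x r <= W y s)%E.
Proof.
move=> xy; apply: integral_subset_le => //; try exact: measurable_metric_ball.
move=> z; rewrite !ballEmdist /= => xz.
by have := metric_triangle y x z; rewrite (metric_sym y x); lra.
Qed.

Lemma power_integral_ball_le q g x r y s : LC X g -> mdist x y + r <= s ->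
  (power_integral mu w q g x r <= power_integral mu w q g y s)%E.
Proof.
move=> gL xy; apply: integral_subset_le; try exact: measurable_metric_ball.
- exact: measurable_weighted_power.
- exact: weighted_power_ge0.
move=> z; rewrite !ballEmdist /= => xz.
by have := metric_triangle y x z; rewrite (metric_sym y x); lra.
Qed.

Variables (K Dw : R).
Hypothesis K_ge3 : 3 <= K.
Hypothesis Dw_ge1 : 1 <= Dw.
Hypothesis w_doubling : forall x r, Omega x -> 0 < r <= 8 * K * dOmega x ->
  (W x r <= Dw%:E * W x (r / 2))%E.

Lemma weight_doubling_iter n x r : Omega x ->
  0 < r -> 2 ^+ n * r <= 8 * K * dOmega x ->
  (W x (2 ^+ n * r) <= (Dw ^+ n)%:E * W x r)%E.
Proof.
move=> Ox r0; elim: n => [|n IH] rK; first by rewrite !expr0 !mul1r mul1e.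
have r0' : 0 < 2 ^+ n * r by rewrite mulr_gt0// exprn_gt0.
apply: le_trans (w_doubling Ox _) _.
  by rewrite rK andbT mulr_gt0// exprn_gt0.
rewrite (_ : 2 ^+ n.+1 * r / 2 = 2 ^+ n * r); last by rewrite exprS; lra.
rewrite (exprS Dw) EFinM -muleA lee_wpmul2l ?lee_fin ?(le_trans ler01)//.
by apply: IH; apply: le_trans rK; rewrite exprS; lra.
Qed.

(** The radii are bounded by a multiple of the distance to the boundary, for the
    doubling condition to apply, and by [rho], which will be the distance from
    the base point [x] to the boundary: the maximal function at [x] then
    controls the means over all these balls that come close to [x]. *)
Definition high_balls (q : R) (g : X -> R) (rho t : R) : set (X * R) :=
  [set b | [/\ Omega b.1, 0 < b.2 < K * dOmega b.1, b.2 < rho &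
    ((t `^ q)%:E * W b.1 b.2 < power_integral mu w q g b.1 b.2)%E]].

(** Uncentred balls make the superlevel set of the maximal function open. *)
Definition high_set q g rho t : set X :=
  \bigcup_(b in high_balls q g rho t) ball b.1 b.2.

Lemma open_high_set q g rho t : open (high_set q g rho t).
Proof. by apply: bigcup_open => b _; exact: open_metric_ball. Qed.

Lemma notin_high_set q g rho t z r : Omega z -> ~ high_set q g rho t z ->
  0 < r < K * dOmega z -> r < rho ->
  (power_integral mu w q g z r <= (t `^ q)%:E * W z r)%E.
Proof.
move=> Oz zH rK rrho; rewrite leNgt; apply/negP => H; apply: zH.
exists (z, r) => //=; rewrite ballEmdist /= mdistxx.
by case/andP: rK.
Qed.

Variables (q : R) (g : X -> R) (x : X) (tau t : R).
Hypothesis gL : LC X g.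
Hypothesis Ox : Omega x.
Hypothesis t_gt0 : 0 < t.
Hypothesis dx_gt0 : 0 < dOmega x.
Hypothesis tau_max : forall r, 0 < r < K * dOmega x ->
  (power_integral mu w q g x r <= (tau `^ q)%:E * W x r)%E.
Hypothesis tau_t : Dw ^+ 3 * tau `^ q <= t `^ q.

Local Notation H := (high_balls q g (dOmega x) t).

(** A ball of radius [s] meeting [ball x s] is comparable to [ball x (3 * s)],
    whose mean is at most [tau] up to doubling. *)
Lemma high_balls_small y s r : H (y, s) -> mdist x y < r + s -> s < r.
Proof.
move=> [/= Oy /andP[s0 sK] sd]; rewrite ltNge => /negP yH xys.
rewrite ltNge; apply/negP => rs; apply: yH.
have K0 : 0 <= K := le_trans (ler0n _ 3) K_ge3.
apply: (@le_trans _ _ (power_integral mu w q g x (3 * s))).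
  by apply: power_integral_ball_le => //; rewrite metric_sym; lra.
apply: (@le_trans _ _ ((tau `^ q)%:E * W x (3 * s))%E).
  apply: tau_max; rewrite mulr_gt0//=.
  by apply: (@lt_le_trans _ _ (3 * dOmega x)); rewrite ?ltr_pM2l// ler_wpM2r// ltW.
apply: (@le_trans _ _ ((tau `^ q)%:E * ((Dw ^+ 3)%:E * W y s))%E).
  rewrite lee_wpmul2l ?lee_fin ?powR_ge0//.
  apply: (@le_trans _ _ (W y (2 ^+ 3 * s))).
    by apply: weight_ball_le; rewrite (_ : 2 ^+ 3 = 8); [lra|rewrite -natrX].
  apply: weight_doubling_iter => //.
  by rewrite (_ : 2 ^+ 3 = 8); [lra|rewrite -natrX].
rewrite muleA -EFinM mulrC lee_wpmul2r ?lee_fin//.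
exact: weight_ge0.
Qed.

(** A high ball containing [x] would be smaller than its own radius. *)
Lemma center_notin_high_set : ~ high_set q g (dOmega x) t x.
Proof.
move=> [[y s] yH]; rewrite ballEmdist /= => yx.
have s0 : 0 < s by case: yH => _ /andP[].
have := @high_balls_small y s s yH; rewrite ltxx metric_sym.
by move=> /(_ ltac:(lra)).
Qed.

(** The high balls meeting [ball x r] have radius less than [r], so they stay in
    [ball x (3 * r)].  On each of them the integral of [g^q w] exceeds
    [t^q w(B)], so disjoint ones have total weight at most [t^(- q)] times that
    integral over [ball x (3 * r)], which [tau_max] bounds; doubling absorbs the
    dilations of the covering lemma. *)
Lemma weak_type_high_set r : 0 < r -> 3 * r < K * dOmega x ->
  (weight_of mu w (high_set q g (dOmega x) t `&` ball x r) <=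
   (Dw ^+ 5 * tau `^ q / t `^ q)%:E * W x r)%E.
Proof.
move=> r0 rK.
have mball y s : measurable (ball y s) := measurable_metric_ball borelX y s.
have tq0 : 0 < t `^ q by rewrite powR_gt0.
have Dw0 n : 0 <= Dw ^+ n by rewrite exprn_ge0// (le_trans ler01).
pose F := [set b | H b /\ mdist x b.1 < r + b.2].
have eight : 2 ^+ 3 = 8 :> R by rewrite -natrX.
have four : 2 ^+ 2 = 4 :> R by rewrite -natrX.
have FE b : F b -> [/\ 0 < b.2 <= r, ball b.1 b.2 `<=` ball x (3 * r),
    (0 < mu (ball b.1 b.2))%E &
    (W b.1 (5 * b.2)%R <=
      (Dw ^+ 3 / t `^ q)%:E * power_integral mu w q g b.1 b.2)%E].
  case: b => y s [/= yH xy]; have sr := high_balls_small yH xy.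
  have [/= Oy /andP[s0 sK] _ yH'] := yH; split.
  - by rewrite s0 ltW.
  - move=> z; rewrite !ballEmdist /= => yz.
    by have := metric_triangle x y z; lra.
  - by case/andP: (mu_ball y s0).
  apply: (@le_trans _ _ ((Dw ^+ 3)%:E * W y s)%E).
    apply: (@le_trans _ _ (W y (2 ^+ 3 * s))).
      by apply: weight_ball_le; rewrite eight mdistxx; lra.
    by apply: weight_doubling_iter => //; rewrite eight; lra.
  rewrite (EFinM (Dw ^+ 3)) -muleA lee_wpmul2l ?lee_fin// lee_pdivlMl//.
  exact: ltW.
apply: (@le_trans _ _ ((Dw ^+ 3 / t `^ q)%:E * power_integral mu w q g x (3 * r))%E).
  apply: (@vitali_integral_le _ _ _ mu borelX F r) => //.
  - exact: measurable_weighted_power.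
  - exact: weighted_power_ge0.
  - by rewrite divr_ge0// ltW.
  - by have /andP[] := mu_ball x (mulr_gt0 (ltr0n R 3) r0).
  - apply: measurableI => //; apply: (open_measurable_metric borelX).
    exact: open_high_set.
  - move=> z [[b bH bz] xz]; exists b => //; split => //.
    move: bz xz; rewrite !ballEmdist /= => bz xz.
    by have := metric_triangle x z b.1; rewrite (metric_sym z); lra.
have HM : (power_integral mu w q g x (3 * r) <=
    (tau `^ q)%:E * ((Dw ^+ 2)%:E * W x r))%E.
  apply: (@le_trans _ _ ((tau `^ q)%:E * W x (3 * r))%E).
    by apply: tau_max; rewrite rK andbT mulr_gt0.
  rewrite lee_wpmul2l ?lee_fin ?powR_ge0//.
  apply: (@le_trans _ _ (W x (2 ^+ 2 * r))).
    by apply: weight_ball_le; rewrite four mdistxx; lra.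
  by apply: weight_doubling_iter => //; rewrite four; lra.
apply: (@le_trans _ _ ((Dw ^+ 3 / t `^ q)%:E *
    ((tau `^ q)%:E * ((Dw ^+ 2)%:E * W x r)))%E).
  by rewrite lee_wpmul2l// lee_fin divr_ge0// ltW.
rewrite !muleA -!EFinM lee_wpmul2r ?weight_ge0// lee_fin.
by rewrite (exprD Dw 3 2) le_eqVlt; apply/orP; left; apply/eqP; lra.
Qed.

End level_sets.

(** * Averages over levels *)

Section multilevel_function.
Context {R : realType} {X : metricType R}.
Variables (M : R) (E : nat -> set X).
Hypothesis M2 : 2 <= M.
Hypothesis E_open : forall i, open (E i).

Definition level_sum (k : nat) (y : X) : R :=
  \sum_(i < k) M ^+ i.+1 * \1_(E i) y.

Definition multilevel (k : nat) (y : X) : R := k%:R^-1 * level_sum k y.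

Let M0 : 0 <= M. Proof. exact: le_trans M2. Qed.

Lemma level_sum_ge0 k y : 0 <= level_sum k y.
Proof. by apply: sumr_ge0 => i _; rewrite mulr_ge0 ?exprn_ge0. Qed.

Lemma multilevel_ge0 k y : 0 <= multilevel k y.
Proof. by rewrite mulr_ge0 ?invr_ge0 ?level_sum_ge0. Qed.

Lemma level_sum_le k y : level_sum k y <= 2 * M ^+ k.
Proof.
rewrite /level_sum; elim: k => [|k IH]; first by rewrite big_ord0 mulr_ge0 ?exprn_ge0.
rewrite big_ord_recr/=; have Mk : 0 <= M ^+ k by rewrite exprn_ge0.
have : M ^+ k.+1 * \1_(E k) y <= M ^+ k.+1.
  by rewrite ler_piMr ?exprn_ge0// indicE; case: (_ \in _).
have : 2 * M ^+ k <= M ^+ k.+1 by rewrite exprS ler_wpM2r.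
by move: IH; lra.
Qed.

(** The last level reached dominates the sum of all the previous ones. *)
Lemma level_sum_powR_le p k y : 0 < p ->
  level_sum k y `^ p <= \sum_(i < k) 2 `^ p * (M ^+ i.+1) `^ p * \1_(E i) y.
Proof.
move=> p0; elim: k => [|k IH].
  by rewrite /level_sum !big_ord0 powR0// gt_eqF.
have S0 : 0 <= \sum_(i < k) 2 `^ p * (M ^+ i.+1) `^ p * \1_(E i) y.
  by apply: sumr_ge0 => i _; rewrite !mulr_ge0 ?powR_ge0.
have := level_sum_le k.+1 y; rewrite {1 2}/level_sum !big_ord_recr/= !indicE.
case: (_ \in _); last by rewrite !mulr0 !addr0.
rewrite !mulr1 => le2M; apply: (@le_trans _ _ (2 `^ p * (M ^+ k.+1) `^ p)).
  rewrite -powRM ?exprn_ge0//; apply: ge0_ler_powR => //; first exact: ltW.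
    by rewrite nnegrE addr_ge0 ?exprn_ge0//; exact: level_sum_ge0.
  by rewrite nnegrE mulr_ge0 ?exprn_ge0.
by rewrite lerDr.
Qed.

Lemma indic_open_LC (A : set X) : open A -> LC X (\1_A : X -> R).
Proof.
move=> oA y a /=; rewrite !lte_fin indicE => ay.
have [yA|yA] := boolP (y \in A).
  exists A; first by apply: open_nbhs_nbhs; split => //; rewrite -inE.
  by move=> z Az; rewrite lte_fin indicE mem_set//; move: ay; rewrite yA.
exists setT; first exact: filterT.
move=> z _; rewrite lte_fin indicE (lt_le_trans ay)// (negbTE yA)/=.
by case: (_ \in _).
Qed.

(** Near [y] all the open sets [E_i] that contain [y] persist. *)
Lemma multilevel_LC k : LC X (multilevel k).
Proof.
move=> y a; rewrite /= lte_fin => ay.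
exists [set z | forall i, (i < k)%N -> E i y -> E i z].
  elim: k {ay} => [|k IH]; first by apply: filterS filterT.
  have nk : nbhs y [set z | E k y -> E k z].
    have [Ey|Ey] := pselect (E k y).
      apply: (@filterS _ _ _ (E k)) => [z Ez _|//]; first exact: Ez.
      exact: open_nbhs_nbhs.
    by apply: filterS filterT => z _ /=.
  apply: filterS2 IH nk => z Iz kz i; rewrite ltnS leq_eqVlt => /predU1P[->|]//.
  exact: Iz.
move=> z /= zE; rewrite lte_fin (lt_le_trans ay)//.
rewrite ler_wpM2l ?invr_ge0//; apply: ler_sum => i _.
rewrite ler_wpM2l ?exprn_ge0// !indicE.
have [Ey|Ey] := boolP (y \in E i); last by case: (_ \in _).
by rewrite mem_set//; apply: zE => //; rewrite -inE.
Qed.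

Lemma multilevel_bounded k :
  (forall y, 0 <= multilevel k y) /\ exists B, forall y, multilevel k y <= B.
Proof.
split; first exact: multilevel_ge0.
exists (k%:R^-1 * (2 * M ^+ k)) => y.
by rewrite ler_wpM2l ?invr_ge0// level_sum_le.
Qed.

(** The line integral of the average of the [k] functions [M^i 1_{E_i}] is the
    average of the line integrals, hence at least the smallest. *)
Lemma multilevel_chebyshev (c : curve X) (k : nat) (delta : R) : (0 < k)%N ->
  (curve_integral (multilevel k) c < delta%:E)%E ->
  exists i, let O := `[0, fine (len c)]%classic `&`
                     arclength_param c @^-1` E i in
    [/\ (i < k)%N, measurable O &
        (lebesgue_measure O < (delta / M ^+ i.+1)%:E)%E].
Proof.
move=> k0 I; apply: contrapT => H; move: I; rewrite ltNge => /negP; apply.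
pose L := fine (len c).
pose O i : set R := `[0%R, L]%classic `&` arclength_param c @^-1` E i.
have mind i : measurable_fun (`[0, L] : set R)
    ((fun u => (\1_(E i) (arclength_param c u))%:E) : R -> \bar R).
  exact: (measurable_fun_arclength_param (indic_open_LC (E_open i))).
have mO i : measurable (O i).
  have := mind i (measurable_itv _) [set 1%E] (emeasurable_set1 _).
  rewrite (_ : _ `&` _ = O i)//; apply/seteqP; split => u /= [uL].
    rewrite indicE; case: (boolP (_ \in _)) => [|_ /= /eqP].
      by rewrite inE.
    by rewrite eqe eq_sym oner_eq0.
  by move=> Eu; split => //; rewrite indicE mem_set.
have M_gt0 i : 0 < M ^+ i by rewrite exprn_gt0// (lt_le_trans _ M2).
have H' i : (i < k)%N -> (delta%:E <= (M ^+ i.+1)%:E * lebesgue_measure (O i))%E.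
  move=> ik; rewrite leNgt; apply/negP => Hi; apply: H; exists i; split => //; first exact: mO.
  by rewrite mulrC EFinM lte_pdivlMl.
rewrite /curve_integral -/L /multilevel /level_sum.
rewrite (_ : \int[_]_(u in _) _ = \sum_(i < k) (k%:R^-1 * M ^+ i.+1)%:E *
    lebesgue_measure (O i))%E; last first.
  transitivity (\int[lebesgue_measure]_(u in `[0%R, L])
     (\sum_(i < k) (k%:R^-1 * M ^+ i.+1)%:E *
       (\1_(E i) (arclength_param c u))%:E))%E.
    apply: eq_integral => u _; rewrite mulr_sumr -sumEFin.
    by apply: eq_bigr => i _; rewrite mulrA EFinM.
  rewrite ge0_integral_sum//=; last 2 first.
  - by move=> i; apply: measurable_funeM; exact: (mind i).
  - by move=> i u _; rewrite mule_ge0// lee_fin ?mulr_ge0 ?invr_ge0 ?(ltW (M_gt0 _)).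
  apply: eq_bigr => i _; rewrite ge0_integralZl//=; last 2 first.
  - exact: (mind i).
  - by rewrite lee_fin mulr_ge0 ?invr_ge0 ?(ltW (M_gt0 _)).
  congr (_ * _)%E.
  rewrite [LHS](_ : _ = \int[lebesgue_measure]_(u in `[0%R, L]) (\1_(O i) u)%:E)%E.
    rewrite integral_indic//; last exact: mO.
    rewrite (_ : O i `&` _ = O i)//.
    by apply/seteqP; split=> [u []//|u [? ?]].
  apply: eq_integral => u; rewrite inE => uL; congr EFin; rewrite !indicE.
  congr (nat_of_bool _)%:R; apply/idP/idP; rewrite !inE; first by [].
  by case.
rewrite [leLHS](_ : _ = \sum_(i < k) (k%:R^-1 * delta)%:E)%E; last first.
  rewrite sumEFin sumr_const card_ord -[_ *+ k]mulr_natl mulrA divff ?mul1r//.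
  by rewrite pnatr_eq0 -lt0n.
apply: lee_sum => i _; rewrite !EFinM -muleA lee_wpmul2l ?lee_fin ?invr_ge0//.
exact: H'.
Qed.

End multilevel_function.

Section multilevel_power.
Context {R : realType} {d : measure_display} {X : metricMeasurableType R d}.
Variables (mu : {measure set X -> \bar R}) (w : X -> R).
Hypothesis borelX : borel X `<=` (measurable : set_system X).
Hypothesis w_meas : measurable_fun setT w.
Hypothesis w_ge0 : forall x, 0 <= w x.
Variables (M : R) (E : nat -> set X).
Hypothesis M2 : 2 <= M.
Hypothesis E_open : forall i, open (E i).

Lemma power_integral_multilevel p k x r (b : nat -> R) : 0 < p ->
  (forall i, 0 <= b i) ->
  (forall i, (i < k)%N -> weight_of mu w (E i `&` ball x r) <=
     (b i)%:E * weight_of mu w (ball x r))%E ->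
  (power_integral mu w p (multilevel M E k) x r <=
   (k%:R^-1 `^ p * \sum_(i < k) 2 `^ p * (M ^+ i.+1) `^ p * b i)%:E *
   weight_of mu w (ball x r))%E.
Proof.
move=> p0 b0 Eb; pose B := ball x r.
have mB : measurable B by exact: measurable_metric_ball.
have mE i : measurable (E i) by exact: open_measurable_metric.
have M0 : 0 <= M := le_trans (ler0n _ 2) M2.
pose a i := k%:R^-1 `^ p * (2 `^ p * (M ^+ i.+1) `^ p).
have a0 i : 0 <= a i by rewrite !mulr_ge0 ?powR_ge0.
have mIw i : measurable_fun B (EFin \o (fun y => \1_(E i) y * w y)).
  apply/measurable_EFinP; apply: measurable_funM.
    exact: measurable_indic.
  exact: measurable_funS w_meas.
have Iw0 i y : 0 <= \1_(E i) y * w y by rewrite mulr_ge0.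
have mh : measurable_fun setT (fun y => `|multilevel M E k y| `^ p * w y).
  by apply: measurable_weighted_power => //; exact: multilevel_LC.
apply: (@le_trans _ _
  (\int[mu]_(y in B) (\sum_(i < k) (a i)%:E * (\1_(E i) y * w y)%:E))%E).
  apply: ge0_le_integral => //.
  - by move=> y _; rewrite lee_fin weighted_power_ge0.
  - by apply/measurable_EFinP; exact: measurable_funS mh.
  - by apply: emeasurable_sum => i; apply: measurable_funeM; exact: mIw.
  move=> y _; under eq_bigr do rewrite -EFinM mulrA; rewrite sumEFin lee_fin.
  rewrite -mulr_suml ler_wpM2r// ger0_norm ?multilevel_ge0//.
  rewrite /multilevel powRM ?invr_ge0 ?level_sum_ge0//.
  apply: (le_trans (ler_wpM2l (powR_ge0 _ _) (level_sum_powR_le E M2 k y p0))).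
  by rewrite mulr_sumr; apply: ler_sum => i _; rewrite /a -!mulrA.
rewrite ge0_integral_sum//; last 2 first.
- by move=> i; apply: measurable_funeM; exact: mIw.
- by move=> i y _; rewrite mule_ge0 ?lee_fin.
apply: (@le_trans _ _ (\sum_(i < k) (a i * b i)%:E * weight_of mu w B)%E).
  apply: lee_sum => i _; rewrite ge0_integralZl//; last 3 first.
  - exact: (mIw i).
  - by move=> y _; rewrite lee_fin.
  - by rewrite lee_fin.
  rewrite (EFinM (a i)) -muleA lee_wpmul2l ?lee_fin//; apply: le_trans (Eb i _) => //.
  rewrite /weight_of setIC integral_mkcondr le_eqVlt; apply/orP; left; apply/eqP.
  apply: eq_integral => y _; rewrite patchE indicE.
  by case: ifPn; rewrite ?mul1r ?mul0r.
rewrite -ge0_sume_distrl; last by move=> i _; rewrite lee_fin mulr_ge0.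
rewrite sumEFin lee_wpmul2r ?weight_ge0// lee_fin mulr_sumr.
by apply: ler_sum => i _; rewrite /a !mulrA.
Qed.

End multilevel_power.

(** * Chains of curves *)

Section curve_chains.
Context {R : realType} {X : metricType R}.
Variable g : X -> R.
Hypothesis gL : LC X g.
Hypothesis g0 : forall x, 0 <= g x.

Definition joined (x : X) (E : set X) (l I : R) : Prop :=
  exists c : curve X, [/\ c (cstart c) = x, E (c (cend c)),
    (len c <= l%:E)%E & (curve_integral g c <= I%:E)%E].

Lemma joined_trans x y E l1 I1 l2 I2 : joined x [set y] l1 I1 ->
  joined y E l2 I2 -> joined x E (l1 + l2) (I1 + I2).
Proof.
move=> [c1 [c1x c1y l1c I1c]] [c2 [c2y c2E l2c I2c]].
have c12 : c1 (cend c1) = c2 (cstart c2) by rewrite c1y c2y.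
exists (concat c12); rewrite concat_start concat_end; split => //.
  by rewrite len_concat EFinD leeD.
by apply: le_trans (curve_integral_concat c12 gL g0) _; rewrite EFinD leeD.
Qed.

Lemma joined_le x E l I l' I' : l <= l' -> I <= I' ->
  joined x E l I -> joined x E l' I'.
Proof.
move=> ll' II' [c [cx cE lc Ic]]; exists c; split => //.
  by rewrite (le_trans lc)// lee_fin.
by rewrite (le_trans Ic)// lee_fin.
Qed.

(** Each step advances along [[0, L]] by at least [eta], so finitely many
    steps suffice and their costs telescope. *)
Lemma joined_chain (E : set X) (sigma : R -> X) (G : set R)
    (L eta a b l0 I0 : R) : 0 < eta -> 0 <= a -> 0 <= b ->
  (forall u, 0 <= u <= L -> G u -> joined (sigma u) E l0 I0 \/
     exists u', [/\ u + eta <= u' <= L, G u' &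
       joined (sigma u) [set sigma u'] (a * (u' - u)) (b * (u' - u))]) ->
  forall u, 0 <= u <= L -> G u ->
    joined (sigma u) E (a * (L - u) + l0) (b * (L - u) + I0).
Proof.
move=> eta0 a0 b0 step u uL Gu.
have [n] : exists n, L - u <= n%:R * eta.
  exists (Num.truncn ((L - u) / eta)).+1.
  by rewrite -ler_pdivrMr// ltW// truncnS_gt.
elim: n u uL Gu => [|n IH] u uL Gu un.
  have [|[u' [? ? _]]] := step u uL Gu; last by lra.
  by apply: joined_le; rewrite lerDr mulr_ge0// subr_ge0; case/andP: uL.
have [|[u' [/andP[uu' u'L] Gu' j]]] := step u uL Gu.
  by apply: joined_le; rewrite lerDr mulr_ge0// subr_ge0; case/andP: uL.
have u'L' : 0 <= u' <= L by move: uL; rewrite u'L; lra.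
have un' : L - u' <= n%:R * eta by move: un; rewrite -natr1 mulrDl mul1r; lra.
by apply: joined_le (joined_trans j (IH _ u'L' Gu' un')); lra.
Qed.

End curve_chains.

(** * Lowering the exponent *)

Section lower_exponent.
Context {R : realType} {d : measure_display} {X : metricMeasurableType R d}.
Variables (mu : {measure set X -> \bar R}) (w : X -> R).
Hypothesis borelX : borel X `<=` (measurable : set_system X).
Hypothesis w_meas : measurable_fun setT w.
Hypothesis w_ge0 : forall x, 0 <= w x.

(** A crude substitute for Jensen's inequality: values above [t] are paid for
    by the integral of the larger power, the others by [t] itself. *)
Lemma power_integral_lower p q g x r t : LC X g ->
  1 <= p -> p <= q -> 0 < t ->
  (power_integral mu w q g x r <= (t `^ q)%:E * weight_of mu w (ball x r))%E ->
  (power_integral mu w p g x r <= ((2 * t) `^ p)%:E * weight_of mu w (ball x r))%E.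
Proof.
move=> gL p1 pq t0 H; pose B := ball x r.
have mB : measurable B by exact: measurable_metric_ball.
have mg s : measurable_fun B (EFin \o (fun y => `|g y| `^ s * w y)).
  by apply/measurable_EFinP; apply: measurable_funS (measurable_weighted_power borelX w_meas s gL).
have mw : measurable_fun B (EFin \o w).
  by apply/measurable_EFinP; exact: measurable_funS w_meas.
have p0 : 0 < p := lt_le_trans ltr01 p1.
apply: (@le_trans _ _ (\int[mu]_(y in B) ((t `^ p)%:E * (w y)%:E +
    (t `^ (p - q))%:E * (`|g y| `^ q * w y)%:E))%E).
  apply: ge0_le_integral => //.
  - by move=> y _; rewrite lee_fin weighted_power_ge0.
  - exact: (mg p).
  - by apply: emeasurable_funD; apply: measurable_funeM; [exact: mw|exact: (mg q)].
  move=> y _; rewrite -!EFinM -EFinD lee_fin mulrA -mulrDl ler_wpM2r//.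
  have [gt|tg] := leP `|g y| t.
    rewrite ler_wpDr ?mulr_ge0 ?powR_ge0//.
    by apply: ge0_ler_powR; rewrite ?nnegrE// ltW.
  rewrite ler_wpDl ?powR_ge0//.
  have g0 : 0 < `|g y| := lt_trans t0 tg.
  rewrite -[X in _ `^ X](subrK q) powRD; last by rewrite (gt_eqF g0) implybT.
  rewrite ler_wpM2r ?powR_ge0//.
  rewrite -(opprB q p) !powRN lef_pV2 ?posrE ?powR_gt0//.
  by apply: ge0_ler_powR; rewrite ?nnegrE ?subr_ge0// ltW.
rewrite ge0_integralD//; last 4 first.
- by move=> y _; rewrite mule_ge0 ?lee_fin ?powR_ge0.
- by apply: measurable_funeM; exact: mw.
- by move=> y _; rewrite mule_ge0 ?lee_fin ?powR_ge0 ?weighted_power_ge0.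
- by apply: measurable_funeM; exact: (mg q).
rewrite ge0_integralZl//; last 2 first.
- by move=> y _; rewrite lee_fin.
- by rewrite lee_fin powR_ge0.
rewrite ge0_integralZl//; last 3 first.
- exact: (mg q).
- by move=> y _; rewrite lee_fin weighted_power_ge0.
- by rewrite lee_fin powR_ge0.
apply: (@le_trans _ _ ((t `^ p)%:E * weight_of mu w B +
   (t `^ (p - q))%:E * ((t `^ q)%:E * weight_of mu w B))%E).
  by rewrite leeD2l// lee_wpmul2l// lee_fin powR_ge0.
rewrite muleA -EFinM -powRD ?subrK; last by rewrite (gt_eqF t0) implybT.
rewrite -ge0_muleDl ?lee_fin ?powR_ge0//.
rewrite -EFinD lee_wpmul2r ?weight_ge0// lee_fin.
rewrite powRM ?(ltW t0)// -mulr2n -[_ *+ 2]mulr_natl ler_wpM2r ?powR_ge0//.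
by rewrite -[leLHS]powRr1// ler_powR// ler1n.
Qed.

End lower_exponent.

(** * From the levels [M^i * tau] to the level [tau] *)

Section self_improvement.
Context {R : realType} {d : measure_display} {X : metricMeasurableType R d}.
Variables (mu : {measure set X -> \bar R}) (Omega : set X) (w : X -> R).
Hypothesis borelX : borel X `<=` (measurable : set_system X).
Hypothesis mu_ball : forall (x : X) r, 0 < r -> (0 < mu (ball x r) < +oo)%E.
Hypothesis Omega_open : open Omega.
Hypothesis Omega_proper : ~` Omega !=set0.
Hypothesis w_meas : measurable_fun setT w.
Hypothesis w_ge0 : forall x, 0 <= w x.
Hypothesis w_fin : forall (x : X) (r : R), 0 < r ->
  (weight_of mu w (ball x r) < +oo)%E.
Hypothesis w_gt0 : forall x r, Omega x -> 0 < r ->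
  (0 < weight_of mu w (ball x r))%E.

Local Notation dOmega x := (dist_set x (~` Omega)).

Let dOmega_gt0 x : Omega x -> 0 < dOmega x.
Proof. by move=> Ox; exact: dist_set_gt0. Qed.

Lemma curve_of_inf_lt (g : X -> R) (S : set (curve X)) (v : R) :
  (ereal_inf [set curve_integral g c | c in S] < v%:E)%E ->
  exists2 c, S c & (curve_integral g c < v%:E)%E.
Proof. by move=> /ereal_inf_lt[_ [c Sc <-] cv]; exists c. Qed.

(** The bound by [C * tau] of the quotients that [alpha] takes the supremum of,
    with the division by the distance cleared. *)
Definition hardy_at (N K q C tau : R) : Prop :=
  forall x, Omega x -> forall g, LC X g -> (forall y, 0 <= g y <= 1) ->
  (maximal mu Omega q w K g x <= tau%:E)%E ->
  (ereal_inf [set curve_integral g c | c in curves_to N x (~` Omega)] <=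
   (C * tau * dOmega x)%:E)%E.

Variables (p0 p CG nuH kH CA nuP kP : R).
Hypothesis p0_ge1 : 1 <= p0.
Hypothesis p_gt0 : 0 < p.
Hypothesis CG_gt0 : 0 < CG.
Hypothesis CA_gt0 : 0 < CA.
Hypothesis nuH_gt0 : 0 < nuH.
Hypothesis nuP_gt0 : 0 < nuP.
Hypothesis kH_gt1 : 1 < kH.
Hypothesis kP_gt1 : 1 < kP.

Hypothesis hardy : forall g : X -> R, LC X g -> nonneg_bounded g ->
  forall x, Omega x ->
  (ereal_inf [set curve_integral g c | c in curves_to nuH x (~` Omega)] <=
   (CG * dOmega x)%:E * maximal mu Omega p w kH g x)%E.

Hypothesis poincare : forall g : X -> R, LC X g -> nonneg_bounded g ->
  forall x y, Omega x -> Omega y -> mdist x y < dOmega x / (3 * kP) ->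
  (ereal_inf [set curve_integral g c | c in curves_between nuP x y] <=
   (CA * mdist x y)%:E *
     (maximal_restr mu Omega p0 w kP (kP * mdist x y) g x +
      maximal_restr mu Omega p0 w kP (kP * mdist x y) g y))%E.

Variables (q K Dw M C delta : R) (k : nat).
Local Notation N := (2 * nuP * nuH).
(* [3 * kH] and [4] let the maximal function at [x] control the means over the
   balls [ball x (3 * r)], for [r] a radius of the Hardy maximal function or of
   a high ball; [kP] is for the maximal functions of the Poincare inequality. *)
Hypothesis K_def : K = 3 * kH + kP + 4.
Hypothesis Dw_ge1 : 1 <= Dw.
Hypothesis w_doubling : forall x r, Omega x -> 0 < r <= 8 * K * dOmega x ->
  (weight_of mu w (ball x r) <= Dw%:E * weight_of mu w (ball x (r / 2)))%E.
Hypothesis M_ge2 : 2 <= M.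
Hypothesis M_Dw : Dw ^+ 3 <= M.
Hypothesis p0_q : p0 <= q.
Hypothesis delta_gt0 : 0 < delta.
Hypothesis delta_K : 6 * K * kP * delta <= 1.
Hypothesis k_gt0 : (0 < k)%N.
(* The left side bounds the [p]-means of the average over levels; divided by
   [2 * CG] on the right so that the Hardy inequality yields half of [delta]. *)
Hypothesis k_large :
  k%:R^-1 `^ p * \sum_(i < k) 2 `^ p * (M ^+ i.+1) `^ p *
    (Dw ^+ 5 / (M ^+ i.+1) `^ q) <= (delta / (2 * CG)) `^ p.
Hypothesis C_large : 2 * ((4 * CA + 1) * M ^+ k * nuH + 1) <= C.

Let K_ge4 : 4 <= K.
Proof. by rewrite K_def; move: kH_gt1 kP_gt1; lra. Qed.

Let q_ge1 : 1 <= q. Proof. exact: le_trans p0_q. Qed.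

Let M_ge1 i : 1 <= M ^+ i.
Proof. by rewrite exprn_ege1// (le_trans _ M_ge2)// ler1n. Qed.

Let kP_delta_small : 24 * kP * delta <= 1.
Proof.
apply: le_trans delta_K; rewrite ler_wpM2r ?(ltW delta_gt0)//.
by have := K_ge4 => K4; move: kP_gt1 => kP1; rewrite ler_wpM2r//; lra.
Qed.

(** The Hardy inequality applied to the average over the levels [M^i tau] of
    the indicators of the superlevel sets weighted by [M^i]: by the weak type
    bound the contributions of the levels to its [p]-mean are uniformly
    bounded, so averaging makes it small, and some level is rarely met by some
    curve to the boundary. *)
Lemma rarely_high_curve x g tau : Omega x -> LC X g -> 0 < tau ->
  (maximal mu Omega q w K g x <= tau%:E)%E ->
  exists i (c : curve X), let E := high_set mu Omega w K q g (dOmega x) (M ^+ i.+1 * tau) in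
    let O := `[0, fine (len c)]%classic `&` arclength_param c @^-1` E in
    [/\ (i < k)%N, curves_to nuH x (~` Omega) c, ~ E x, measurable O &
        (lebesgue_measure O < (delta * dOmega x / M ^+ i.+1)%:E)%E].
Proof.
move=> Ox gL tau0 gtau; have d0 := dOmega_gt0 Ox.
pose E i := high_set mu Omega w K q g (dOmega x) (M ^+ i.+1 * tau).
have oE i : open (E i) by exact: open_high_set.
have q0 : 0 < q := lt_le_trans ltr01 q_ge1.
have tau_max : forall r, 0 < r < K * dOmega x ->
    (power_integral mu w q g x r <= (tau `^ q)%:E * weight_of mu w (ball x r))%E.
  by apply/(maximal_le w_ge0 w_fin w_gt0) => //; exact: ltW.
have t0 i : 0 < M ^+ i.+1 * tau by rewrite mulr_gt0// (lt_le_trans ltr01).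
have tq i : (M ^+ i.+1 * tau) `^ q = (M ^+ i.+1) `^ q * tau `^ q.
  by rewrite powRM ?(ltW tau0)// (le_trans ler01).
have tau_t i : Dw ^+ 3 * tau `^ q <= (M ^+ i.+1 * tau) `^ q.
  rewrite tq ler_wpM2r ?powR_ge0//.
  apply: (@le_trans _ _ (M ^+ i.+1)); last by rewrite -[leLHS]powRr1 ?ler_powR ?(le_trans ler01).
  by apply: (le_trans M_Dw); rewrite exprS ler_peMr// (le_trans _ M_ge2).
have K3 : 3 <= K by apply: le_trans K_ge4; lra.
pose b i := Dw ^+ 5 / (M ^+ i.+1) `^ q.
have Eb r : 0 < r < kH * dOmega x -> forall i, (i < k)%N ->
    (weight_of mu w (E i `&` ball x r) <= (b i)%:E * weight_of mu w (ball x r))%E.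
  move=> /andP[r0 rk] i ik.
  have rK : 3 * r < K * dOmega x.
    have : 3 * (kH * dOmega x) <= K * dOmega x.
      by rewrite mulrA ler_wpM2r ?(ltW d0)// K_def; move: kH_gt1 kP_gt1; lra.
    by lra.
  have := weak_type_high_set borelX mu_ball w_meas w_ge0 K3 Dw_ge1 w_doubling
    gL Ox (t0 i) d0 tau_max (tau_t i) r0 rK.
  congr (_ <= _%:E * _)%E; rewrite /b tq.
  have taq : tau `^ q != 0 by rewrite gt_eqF// powR_gt0.
  by rewrite -mulf_div divff// mulr1.
have max_h : (maximal mu Omega p w kH (multilevel M E k) x <=
    (delta / (2 * CG))%:E)%E.
  apply/(maximal_le w_ge0 w_fin w_gt0) => //.
    by rewrite divr_ge0// ltW// mulr_gt0.
  move=> r rk; apply: (le_trans (power_integral_multilevel (b := b) borelX w_meas w_ge0 M_ge2 oE p_gt0 _ (Eb r rk))).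
    by move=> i; rewrite divr_ge0 ?powR_ge0// exprn_ge0// (le_trans ler01).
  by rewrite lee_wpmul2r ?weight_ge0// lee_fin.
have [c cH ch] : exists2 c, curves_to nuH x (~` Omega) c &
    (curve_integral (multilevel M E k) c < (delta * dOmega x)%:E)%E.
  apply: curve_of_inf_lt.
  have hb : nonneg_bounded (multilevel M E k) := multilevel_bounded E M_ge2 k.
  apply: le_lt_trans (hardy (multilevel_LC M_ge2 oE (k := k)) hb Ox) _.
  apply: (@le_lt_trans _ _ ((CG * dOmega x)%:E * (delta / (2 * CG))%:E)%E).
    by rewrite lee_wpmul2l// lee_fin mulr_ge0// ltW.
  rewrite -EFinM lte_fin.
  have -> : CG * dOmega x * (delta / (2 * CG)) = delta * dOmega x / 2.
    by rewrite invfM; field; rewrite gt_eqF.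
  by rewrite ltr_pdivrMr// ltr_pMr ?mulr_gt0// ltr1n.
have [i /= [ik mO Oi]] := multilevel_chebyshev M_ge2 oE k_gt0 ch.
exists i, c; split; [exact: ik|exact: cH| |exact: mO|exact: Oi].
exact: (center_notin_high_set borelX w_meas w_ge0 K3 Dw_ge1 w_doubling gL d0 tau_max (tau_t i)).
Qed.

(** The Poincare inequality only looks at means over radii below
    [kP * mdist x y], so it suffices to control those up to [rho]. *)
Lemma low_points_joined g x y rho t (D : R) : LC X g ->
  (forall z, 0 <= g z <= 1) -> 0 < t -> 0 < D ->
  (forall z, z = x \/ z = y -> Omega z /\
     forall r, 0 < r < K * dOmega z -> r < rho ->
     (power_integral mu w q g z r <= (t `^ q)%:E * weight_of mu w (ball z r))%E) ->
  mdist x y < dOmega x / (3 * kP) -> mdist x y <= D -> kP * D <= rho ->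
  joined g x [set y] (nuP * D) ((4 * CA + 1) * t * D).
Proof.
move=> gL g01 t0 D0 low xy xyD Drho.
have [[Ox _] [Oy _]] : (Omega x /\ True) /\ (Omega y /\ True).
  by split; split => //; [have [] := low x (or_introl erefl)|
                          have [] := low y (or_intror erefl)].
have kP0 : 0 < kP := lt_trans ltr01 kP_gt1.
have gb : nonneg_bounded g.
  by split=> [z|]; [case/andP: (g01 z)|exists 1 => z; case/andP: (g01 z)].
have p00 : 0 < p0 := lt_le_trans ltr01 p0_ge1.
have max_le z : z = x \/ z = y ->
    (maximal_restr mu Omega p0 w kP (kP * mdist x y) g z <= (2 * t)%:E)%E.
  move=> /low[Oz lowz]; apply/(maximal_restr_le w_ge0 w_fin w_gt0) => //.
    by rewrite mulr_ge0// ltW.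
  move=> r /andP[r0]; rewrite lt_min => /andP[rk rxy].
  apply: power_integral_lower p0_q t0 _ => //; apply: lowz.
    rewrite r0 (lt_le_trans rk)// ler_wpM2r ?(ltW (dOmega_gt0 Oz))//.
    by rewrite K_def; move: kH_gt1; lra.
  by apply: lt_le_trans rxy _; apply: le_trans Drho; rewrite ler_pM2l.
have [c [cx cy lc] Ic] : exists2 c, curves_between nuP x y c &
    (curve_integral g c < ((4 * CA + 1) * t * D)%:E)%E.
  apply: curve_of_inf_lt.
  apply: le_lt_trans (poincare gL gb Ox Oy xy) _.
  apply: (@le_lt_trans _ _ ((CA * mdist x y)%:E * (2 * t + 2 * t)%:E)%E).
    rewrite lee_wpmul2l ?lee_fin ?mulr_ge0 ?mdist_ge0 ?(ltW CA_gt0)//.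
    by rewrite EFinD; apply: leeD; apply: max_le; [left|right].
  rewrite -EFinM lte_fin.
  have : CA * t * mdist x y <= CA * t * D by rewrite ler_wpM2l// mulr_ge0 ?ltW.
  have : 0 < t * D by rewrite mulr_gt0.
  by lra.
exists c; split => //; last exact: ltW.
by apply: (le_trans lc); rewrite lee_fin ler_wpM2l// ltW.
Qed.

(** The curve of [rarely_high_curve] is walked along in steps between [eta] and
    [2 * eta], where [eta] exceeds the length it spends in the superlevel set
    [E].  As long as the distance to the boundary exceeds [6 * kP * eta], a step
    satisfies the proximity condition of the Poincare inequality; once it does
    not, the assumption at the level [t] finishes. *)
Lemma hardy_at_step tau : 0 < tau ->
  (forall i, (i < k)%N -> hardy_at N K q C (M ^+ i.+1 * tau)) ->
  hardy_at N K q C tau.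
Proof.
move=> tau0 IH x Ox g gL g01 gtau; have d0 := dOmega_gt0 Ox.
have g0 y : 0 <= g y by case/andP: (g01 y).
have [i [c /= [ik [cx cO lc] xE mO Oeta]]] := rarely_high_curve Ox gL tau0 gtau.
set E := high_set _ _ _ _ _ _ _ _ in xE mO Oeta.
set t := M ^+ i.+1 * tau in E xE mO Oeta.
set eta := delta * dOmega x / M ^+ i.+1 in Oeta.
set L := fine (len c) in mO Oeta.
pose sigma := arclength_param c.
have Mi0 : 0 < M ^+ i.+1 := lt_le_trans ltr01 (M_ge1 _).
have t0 : 0 < t by rewrite mulr_gt0.
have kP0 : 0 < kP := lt_trans ltr01 kP_gt1.
have K0 : 0 < K := lt_le_trans (ltr0n _ 4) K_ge4.
have eta0 : 0 < eta by rewrite divr_gt0// mulr_gt0.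
have C0 : 0 < C.
  apply: lt_le_trans C_large; rewrite mulr_gt0// addr_gt0//.
  rewrite !mulr_gt0// ?addr_gt0 ?mulr_gt0//.
  exact: lt_le_trans ltr01 (M_ge1 _).
have eta_delta : eta <= delta * dOmega x.
  by rewrite ler_pdivrMr// ler_peMr ?M_ge1// mulr_ge0// ltW.
have eta_K : 6 * K * kP * eta <= dOmega x.
  apply: (@le_trans _ _ (6 * K * kP * (delta * dOmega x))).
    by rewrite ler_wpM2l// !mulr_ge0// ltW.
  by rewrite mulrA -[leRHS]mul1r ler_wpM2r// ltW.
have L0 : 0 <= L := fine_len_ge0 c.
have LnuH : L <= nuH * dOmega x by rewrite -lee_fin /L fineK ?len_fin_num.
have us : unit_speed L sigma := @arclength_param_unit_speed _ _ c.
have sigma0 : sigma 0 = x by rewrite /sigma arclength_param0.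
have sigmaL : (~` Omega) (sigma L) by rewrite /sigma /L arclength_param_len.
pose G := [set u | Omega (sigma u) /\ ~ E (sigma u)].
have lowG u : G u -> Omega (sigma u) /\
    forall r, 0 < r < K * dOmega (sigma u) -> r < dOmega x ->
    (power_integral mu w q g (sigma u) r <=
      (t `^ q)%:E * weight_of mu w (ball (sigma u) r))%E.
  by move=> [Ou Eu]; split => // r rK rd; exact: notin_high_set Ou Eu rK rd.
(* An interval of length [eta] does not fit into the part of the curve in [E]. *)
have next u : 0 <= u -> u + 2 * eta <= L ->
    exists u', u + eta <= u' <= u + 2 * eta /\ ~ E (sigma u').
  move=> u0 uL; apply: contrapT => no; move: Oeta; rewrite ltNge => /negP; apply.
  apply: (@le_trans _ _ (lebesgue_measure `[u + eta, u + 2 * eta]%classic)).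
    rewrite lebesgue_measure_itv/= lte_fin ifT; last by lra.
    by rewrite -EFinB lee_fin; lra.
  apply: le_measure; rewrite ?inE//.
  move=> v /=; rewrite !in_itv/= => /andP[uv vu]; split; first by apply/andP; split; lra.
  by apply: contrapT => vE; apply: no; exists v; rewrite uv.
have step u : 0 <= u <= L -> G u ->
    joined g (sigma u) (~` Omega) (N * (6 * kP * eta)) ((C + 1) * t * (6 * kP * eta)) \/
    exists u', [/\ u + eta <= u' <= L, G u' &
      joined g (sigma u) [set sigma u'] (nuP * (u' - u)) ((4 * CA + 1) * t * (u' - u))].
  move=> /andP[u0 uL] Gu; have [Ou lowu] := lowG u Gu.
  have du0 := dOmega_gt0 Ou.
  have [du|du] := leP (dOmega (sigma u)) (6 * kP * eta).
    left.
    have max_t : (maximal mu Omega q w K g (sigma u) <= t%:E)%E.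
      apply/(maximal_le w_ge0 w_fin w_gt0) => //; first exact: lt_le_trans ltr01 q_ge1.
        exact: ltW.
      move=> r rK; apply: lowu => //; case/andP: rK => r0 rK.
      apply: (lt_le_trans rK); apply: le_trans eta_K.
      rewrite (_ : 6 * K * kP * eta = K * (6 * kP * eta)); last by ring.
      by rewrite ler_wpM2l// ltW.
    have [c' [c'x c'O lc'] Ic'] : exists2 c', curves_to N (sigma u) (~` Omega) c' &
        (curve_integral g c' < ((C + 1) * t * dOmega (sigma u))%:E)%E.
      apply: curve_of_inf_lt; apply: le_lt_trans (IH i ik _ Ou g gL g01 max_t) _.
      by rewrite lte_fin ltr_pM2r// ltr_pM2r// ltrDl.
    exists c'; split => //.
      by apply: (le_trans lc'); rewrite lee_fin ler_wpM2l// !mulr_ge0// ltW.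
    apply: (le_trans (ltW Ic')); rewrite lee_fin ler_wpM2l//.
    by rewrite mulr_ge0 ?addr_ge0// ltW.
  right.
  have kP6 : 6 * eta < 6 * kP * eta.
    by rewrite ltr_pM2r// -[ltLHS]mulr1 ltr_pM2l.
  (* The curve ends on the boundary, so it cannot be nearly over. *)
  have uL2 : u + 2 * eta <= L.
    have := dist_set_le (sigma u) sigmaL; have := us u L u0 uL (lexx _).
    by lra.
  have [u' [/andP[uu' u'u] Eu']] := next u u0 uL2.
  have d_uu' : mdist (sigma u) (sigma u') <= u' - u by apply: us; lra.
  have Ou' : Omega (sigma u').
    apply: contrapT => Ou'.
    have := @dist_set_le _ _ (sigma u) (sigma u') (~` Omega) Ou'.
    by lra.
  have Gu' : G u' by [].
  exists u'; split => //; first by apply/andP; split; lra.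
  apply: (low_points_joined (rho := dOmega x)) => //.
  - by lra.
  - by move=> z [->|->]; exact: lowG.
  - apply: (le_lt_trans d_uu'); rewrite ltr_pdivlMr ?mulr_gt0//.
    have : (u' - u) * (3 * kP) <= 2 * eta * (3 * kP).
      by rewrite ler_wpM2r ?mulr_ge0 ?(ltW kP0)//; lra.
    by lra.
  - have : kP * (u' - u) <= kP * (2 * eta) by rewrite ler_wpM2l ?(ltW kP0)//; lra.
    have : 4 * (kP * eta) <= K * (kP * eta) by rewrite ler_wpM2r// mulr_ge0// ltW.
    have : 0 < kP * eta by rewrite mulr_gt0.
    by lra.
have e0 : 0 < 6 * kP * eta by apply: mulr_gt0 eta0; rewrite mulr_gt0.
have e4 : 4 * (6 * kP * eta) <= dOmega x.
  apply: le_trans eta_K.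
  rewrite (_ : 6 * K * kP * eta = K * (6 * kP * eta)); last by ring.
  by rewrite ler_wpM2r// ltW.
have a0 : 0 <= nuP by rewrite ltW.
have b0 : 0 <= (4 * CA + 1) * t.
  by apply: mulr_ge0 (ltW t0); rewrite addr_ge0// mulr_ge0// ltW.
have [||c' [c'x c'O lc' Ic']] := joined_chain gL g0 eta0 a0 b0 step (u := 0).
- by rewrite lexx.
- by rewrite /G /= sigma0.
apply: ge_ereal_inf; exists (curve_integral g c').
  exists c' => //; split => //; first by rewrite c'x sigma0.
  apply: (le_trans lc'); rewrite lee_fin subr0.
  have : nuP * L <= nuP * (nuH * dOmega x) by rewrite ler_wpM2l.
  have : nuP * nuH * (4 * (6 * kP * eta)) <= nuP * nuH * dOmega x.
    by rewrite ler_wpM2l// mulr_ge0// ltW.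
  have : 0 <= nuP * nuH * dOmega x by rewrite !mulr_ge0// ltW.
  by lra.
apply: (le_trans Ic'); rewrite lee_fin subr0.
have te : 4 * (t * (6 * kP * eta)) <= tau * dOmega x.
  have -> : 4 * (t * (6 * kP * eta)) = 24 * kP * delta * (tau * dOmega x).
    by rewrite /t /eta; field; rewrite gt_eqF.
  by rewrite -[leRHS]mul1r ler_wpM2r// mulr_ge0// ltW.
have tk : t * L <= M ^+ k * tau * (nuH * dOmega x).
  apply: ler_pM => //; first exact: ltW.
  by rewrite /t ler_wpM2r ?(ltW tau0)// ler_weXn2l// (le_trans _ M_ge2)// ler1n.
have A0 : 0 <= 4 * CA + 1 by rewrite addr_ge0// mulr_ge0// ltW.
have AtL := ler_wpM2l A0 tk.
have td0 : 0 <= tau * dOmega x by rewrite mulr_ge0// ltW.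
have Ctd := ler_wpM2r td0 C_large.
have CT0 := mulr_ge0 (ltW C0) td0.
have Cte : (C + 1) * (4 * (t * (6 * kP * eta))) <= (C + 1) * (tau * dOmega x).
  by rewrite ler_wpM2l// addr_ge0// ltW.
by lra.
Qed.

End self_improvement.

(** * Choice of the parameters and conclusion *)

Section parameters.
Context {R : realType}.

Lemma powR_le2_exists (a s : R) : 1 < a -> 0 < s ->
  exists e, 0 < e < s /\ a `^ e <= 2.
Proof.
move=> a1 s0; have lna : 0 < ln a by rewrite ln_gt0.
have ln2 : 0 < ln 2 :> R by rewrite ln_gt0// ltr1n.
pose e := Num.min (ln 2 / ln a) (s / 2).
have e0 : 0 < e by rewrite lt_min !divr_gt0.
have es : e < s by rewrite /e gt_min; apply/orP; right; lra.
exists e; split; first by rewrite e0.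
apply: (@le_trans _ _ (a `^ (ln 2 / ln a))).
  by rewrite ler_powR ?(ltW a1)// /e ge_min lexx.
rewrite /powR gt_eqF ?(lt_trans ltr01)// divfK ?gt_eqF//.
by rewrite lnK// posrE.
Qed.

(** The averaging factor [k^(1 - p)] tends to zero because [p > 1]. *)
Lemma average_small_exists (p A th : R) : 1 < p -> 0 < A -> 0 < th ->
  exists2 k : nat, (0 < k)%N & k%:R^-1 `^ p * (k%:R * A) <= th.
Proof.
move=> p1 A0 th0; have p10 : 0 < p - 1 by rewrite subr_gt0.
pose k := (Num.truncn ((A / th) `^ (p - 1)^-1)).+1.
exists k => //; have k0 : 0 < k%:R :> R by rewrite ltr0n.
have kA : A / th <= k%:R `^ (p - 1).
  have -> : A / th = ((A / th) `^ (p - 1)^-1) `^ (p - 1).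
    by rewrite -powRrM mulVf ?gt_eqF// powRr1// divr_ge0 ?ltW.
  apply: ge0_ler_powR; rewrite ?nnegrE ?powR_ge0 ?ltW//.
  exact: truncnS_gt.
have -> : k%:R^-1 `^ p * (k%:R * A) = A / k%:R `^ (p - 1).
  rewrite -powR_inv1 ?ltW// -powRrM mulN1r.
  rewrite mulrA mulrC; congr (_ * _).
  rewrite -[X in _ * X]powRr1 ?ltW// -powRD; last by rewrite (gt_eqF k0) implybT.
  by rewrite -powRN; congr (_ `^ _); lra.
rewrite ler_pdivrMr ?powR_gt0// mulrC -ler_pdivrMr//.
Qed.

(** With [q] close to [p] none of the [k] levels dominates. *)
Lemma multilevel_sum_le (M p q B : R) (k : nat) : 1 <= M -> q <= p -> 0 <= B ->
  (M ^+ k) `^ (p - q) <= 2 ->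
  \sum_(i < k) 2 `^ p * (M ^+ i.+1) `^ p * (B / (M ^+ i.+1) `^ q) <=
  k%:R * (2 `^ p * B * 2).
Proof.
move=> M1 qp B0 Mk.
apply: (@le_trans _ _ (\sum_(i < k) 2 `^ p * B * 2)); last first.
  by rewrite sumr_const card_ord -[leLHS]mulr_natl.
apply: ler_sum => i _.
have Mi0 : 0 < M ^+ i.+1 by rewrite exprn_gt0// (lt_le_trans ltr01).
have -> : 2 `^ p * (M ^+ i.+1) `^ p * (B / (M ^+ i.+1) `^ q) =
    2 `^ p * B * (M ^+ i.+1) `^ (p - q).
  have -> : (M ^+ i.+1) `^ p = (M ^+ i.+1) `^ (p - q) * (M ^+ i.+1) `^ q.
    by rewrite -powRD ?subrK// (gt_eqF Mi0) implybT.
  have := powR_gt0 q Mi0; move: ((M ^+ i.+1) `^ q) => v v0.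
  by rewrite -!mulrA (mulrCA v) mulfV ?gt_eqF// mulr1 (mulrC B).
rewrite ler_wpM2l ?mulr_ge0 ?powR_ge0//; apply: le_trans Mk.
apply: ge0_ler_powR; rewrite ?nnegrE ?subr_ge0 ?exprn_ge0 ?(le_trans ler01)//.
by rewrite ler_weXn2l.
Qed.

End parameters.

Section conclusion.
Context {R : realType} {d : measure_display} {X : metricMeasurableType R d}.
Variables (mu : {measure set X -> \bar R}) (Omega : set X) (w : X -> R).
Hypothesis Omega_open : open Omega.
Hypothesis Omega_proper : ~` Omega !=set0.

Local Notation dOmega x := (dist_set x (~` Omega)).

(** Above [1] the bound is trivial, since [g <= 1] and quasiconvexity provides
    short curves to the boundary. *)
Lemma hardy_at_ge1 (CQC N K q C tau : R) : 1 <= CQC -> quasiconvex X CQC ->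
  CQC < N -> N <= C -> 1 <= tau -> hardy_at mu Omega w N K q C tau.
Proof.
move=> CQC1 qc CN NC tau1 x Ox g gL g01 _.
have d0 : 0 < dOmega x by exact: dist_set_gt0.
have CQC0 : 0 < CQC := lt_le_trans ltr01 CQC1.
have N0 : 0 < N := lt_trans CQC0 CN.
have [|y Oy xy] := @dist_set_adherent _ _ x (~` Omega) ((N / CQC - 1) * dOmega x) Omega_proper.
  by rewrite mulr_gt0// subr_gt0 ltr_pdivlMr// mul1r.
have [c [cx cy lc]] := qc x y.
have lN : (len c <= (N * dOmega x)%:E)%E.
  apply: (le_trans lc); rewrite lee_fin.
  have -> : N * dOmega x = CQC * (N / CQC * dOmega x).
    by field; rewrite gt_eqF.
  by rewrite ler_wpM2l ?(ltW CQC0)//; lra.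
apply: ge_ereal_inf; exists (curve_integral g c).
  by exists c => //; split => //; rewrite cy.
apply: (le_trans (curve_integral_le_len c gL g01)); apply: (le_trans lN).
rewrite lee_fin ler_wpM2r ?(ltW d0)//; apply: (le_trans NC).
by rewrite ler_peMr// (le_trans (ltW N0)).
Qed.

(** The value [tau = 0] is reached as a limit of positive values. *)
Lemma hardy_at_alpha (N K q C : R) : 0 < C ->
  (forall tau, 0 < tau -> hardy_at mu Omega w N K q C tau) ->
  forall tau, 0 <= tau -> (alpha mu Omega q w N K tau <= (C * tau)%:E)%E.
Proof.
move=> C0 H tau tau0; apply: ge_ereal_sup => _ [x Ox <-].
apply: ge_ereal_sup => _ [g [gL gtau g01] <-].
have d0 : 0 < dOmega x by exact: dist_set_gt0.
rewrite inver gt_eqF// lee_pdivrMr// -EFinM.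
apply/lee_addgt0Pr => e e0.
have e'0 : 0 < e / (C * dOmega x) by rewrite divr_gt0// mulr_gt0.
have := H (tau + e / (C * dOmega x)) (ltr_wpDl tau0 e'0) x Ox g gL g01.
have -> : C * (tau + e / (C * dOmega x)) * dOmega x = C * tau * dOmega x + e.
  by field; rewrite !gt_eqF.
by apply; apply: (le_trans gtau); rewrite lee_fin lerDl ltW.
Qed.

End conclusion.

Theorem theorem6p1 (R : realType) (d : measure_display)
    (X : metricMeasurableType R d) (mu : {measure set X -> \bar R})
    (D CQC : R) (Omega : set X) (w : X -> R) (p0 p : R) :
  (exists x y : X, x != y) ->
  measure_is_complete mu ->
  borel_regular mu ->
  1 < D ->
  doubling_measure mu D ->
  1 <= CQC ->
  quasiconvex X CQC ->
  open Omega ->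
  Omega !=set0 ->
  Omega `<` setT ->
  1 < p0 ->
  p0 < p ->
  weight mu Omega w ->
  semilocally_doubling mu Omega w ->
  poincare_weight mu CQC Omega p0 w ->
  hardy_weight mu CQC Omega p w ->
  exists q N K Calpha : R,
    [/\ p0 < q < p, CQC < N, 1 < K, 0 < Calpha &
        forall tau : R, 0 <= tau ->
          (alpha mu Omega q w N K tau <= (Calpha * tau)%:E)%E].
Proof.
move=> _ _ [borelX _] _ muD CQC1 qc oO _ OT p01 p0p [bw w0 wfin _] wD.
move=> [_ [CA [nuP [kP [CA0 nuP1 kP1 poincare]]]]].
move=> [_ [CG [nuH [kH [CG0 nuH1 kH1 hardy]]]]].
have Oproper : ~` Omega !=set0.
  apply: contrapT => no; have [_ ] := OT; apply => x _.
  by apply: contrapT => Ox; apply: no; exists x.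
have mu_ball (x : X) (r : R) : 0 < r -> (0 < mu (ball x r) < +oo)%E.
  by move=> r0; have [] := muD x r r0.
have mw := measurable_borel_function borelX bw.
have w_gt0 (x : X) (r : R) : Omega x -> 0 < r -> (0 < weight_of mu w (ball x r))%E.
  move=> Ox r0; have d0 := dist_set_gt0 oO Ox Oproper.
  have [D' _ D'P] := wD (r / dist_set x (~` Omega)) (divr_gt0 r0 d0).
  by have [|] := D'P x r Ox; first by rewrite r0 divfK ?gt_eqF/=.
pose K := 3 * kH + kP + 4.
have K0 : 0 < 8 * K by rewrite /K; lra.
have [Dw Dw1 DwP] := wD (8 * K) K0.
have w_doubling (x : X) (r : R) : Omega x -> 0 < r <= 8 * K * dist_set x (~` Omega) ->
    (weight_of mu w (ball x r) <= Dw%:E * weight_of mu w (ball x (r / 2)))%E.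
  by move=> Ox rK; have [] := DwP x r Ox rK.
have p1 : 1 < p := lt_trans p01 p0p.
have pp : 0 < p := lt_trans ltr01 p1.
have CQC0 : 0 < CQC := lt_le_trans ltr01 CQC1.
have nuP0 : 0 < nuP := lt_trans CQC0 nuP1.
have nuH0 : 0 < nuH := lt_trans CQC0 nuH1.
(* [M >= Dw^3] keeps the base point out of all superlevel sets, and [M >= 2]
   makes the levels lacunary. *)
pose M := Dw ^+ 3 + 2.
have Dw3 : 0 <= Dw ^+ 3 by rewrite exprn_ge0// (le_trans ler01).
have M2 : 2 <= M by rewrite /M; lra.
have MDw : Dw ^+ 3 <= M by rewrite /M; lra.
have KkP : 0 < 6 * K * kP by rewrite mulr_gt0//; lra.
pose delta := (6 * K * kP)^-1.
have delta0 : 0 < delta by rewrite invr_gt0.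
have deltaK : 6 * K * kP * delta <= 1 by rewrite divff// gt_eqF.
have th0 : 0 < (delta / (2 * CG)) `^ p by rewrite powR_gt0// divr_gt0// mulr_gt0.
have Dw5 : 0 < Dw ^+ 5 by rewrite exprn_gt0// (lt_le_trans ltr01).
have A0 : 0 < 2 `^ p * Dw ^+ 5 * 2 by apply: mulr_gt0 => //; apply: mulr_gt0 => //; rewrite powR_gt0.
have [k k0 kth] := average_small_exists p1 A0 th0.
have Mk1 : 1 < M ^+ k by rewrite exprn_egt1 ?(lt_le_trans _ M2) ?ltr1n// -lt0n.
have p0p' : 0 < p - p0 by rewrite subr_gt0.
(* [q] comes after [M] and [k], so that even [M^k] to the power [p - q] is small. *)
have [e [/andP[e0 ep] Mke]] := powR_le2_exists Mk1 p0p'.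
pose q := p - e.
have p0q : p0 <= q by rewrite /q; lra.
pose N := 2 * nuP * nuH.
have CN : CQC < N.
  have : 1 * CQC < nuP * nuH by apply: ltr_pM => //; lra.
  by rewrite /N; lra.
pose C := N + 2 * ((4 * CA + 1) * M ^+ k * nuH + 1).
have B0 : 0 <= (4 * CA + 1) * M ^+ k * nuH.
  rewrite mulr_ge0 ?(ltW nuH0)// mulr_ge0 ?(le_trans ler01 (ltW Mk1))//.
  by rewrite addr_ge0// mulr_ge0// ltW.
have N0 : 0 < N := lt_trans CQC0 CN.
have C0 : 0 < C by rewrite /C; lra.
have Clarge : 2 * ((4 * CA + 1) * M ^+ k * nuH + 1) <= C by rewrite /C; lra.
have NC : N <= C by rewrite /C; lra.
have k_large : k%:R^-1 `^ p * \sum_(i < k) 2 `^ p * (M ^+ i.+1) `^ p *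
    (Dw ^+ 5 / (M ^+ i.+1) `^ q) <= (delta / (2 * CG)) `^ p.
  apply: le_trans kth; rewrite ler_wpM2l ?powR_ge0//.
  apply: multilevel_sum_le; rewrite ?(ltW Dw5)//; [lra|by rewrite /q; lra|].
  by rewrite (_ : p - q = e)// /q; lra.
have step := hardy_at_step borelX mu_ball oO Oproper mw w0 wfin w_gt0 (ltW p01)
  pp CG0 CA0 nuH0 nuP0 kH1 kP1 hardy poincare (erefl K) Dw1 w_doubling M2 MDw
  p0q delta0 deltaK k0 k_large Clarge.
exists q, N, K, C; split => //.
- by rewrite /q; apply/andP; split; lra.
- by rewrite /K; lra.
apply: hardy_at_alpha => // tau tau0.
have M0 : 0 < M := lt_le_trans (ltr0n _ 2) M2.
have [n] : exists n, 1 <= M ^+ n * tau.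
  exists (Num.truncn tau^-1).+1; rewrite -ler_pdivrMr// div1r.
  apply: (le_trans (ltW (truncnS_gt _))).
  apply: (@le_trans _ _ (2 ^+ (Num.truncn tau^-1).+1)).
    by rewrite -natrX ler_nat ltnW// ltn_expl.
  by rewrite lerXn2r// nnegrE ltW.
elim: n tau tau0 => [|n IH] tau tau0 ntau.
  by apply: hardy_at_ge1 CQC1 qc CN NC _ => //; rewrite expr0 mul1r in ntau.
apply: step => // i _; apply: IH; first by rewrite mulr_gt0// exprn_gt0.
apply: (le_trans ntau); rewrite mulrA -exprD ler_pM2r//.
by apply: ler_weXn2l; [lra|rewrite addnS leq_addr].
Qed.
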